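(* Let $\mathcal A=\{(u,v]:0\le u\le v\le1\}$, let $\nu>2$ and let $\rho$ be a semimetric on $\mathcal F$. Assume: (1) There exists $g:\mathbb N\times(0,\infty)\to\mathbb R$ such that for each $n\in\mathbb N$, $\delta>0$, $1\le i\le j\le n$, $\mathrm E^*\{\sup_{f\in\mathcal F_\delta}|S^{Z^o}_{n,i,j}(f)|^\nu\}\le g^{\nu/2}(j-i+1,\delta)$, and a single index $Q_g\in[1,2^{1-2/\nu})$ such that $(\nu/2,g(\cdot,\delta))$ fulfills (S) with index $Q_g$ for every $\delta>0$. (2) There exists $h:\mathbb N\to\mathbb R$ such that for each $n$ and $1\le i\le j\le n$, $\mathrm E^*\{\sup_{f\in\mathcal F}|S^{Z^o}_{n,i,j}(f)|^\nu\}\le h^{\nu/2}(j-i+1)$, and $(\nu/2,h)$ fulfills (S) with some index $Q_h\in[1,2^{1-2/\nu})$. (3) $\lim_{\delta\downarrow0}\limsup_{n\to\infty}g(n,\delta)/n=0$. (4) There is $C\ge0$ with $\limsup_{n\to\infty}h(\lfloor n\varepsilon\rfloor)/n\le C\varepsilon$ for each $0<\varepsilon\le1$ (convention $h(0)=0$). Then the smoothed process $\mathbb Z_n^s$ satisfies (AEC) on $\mathcal A\times\mathcal F$ for the semimetric $\tau((A,f),(B,g))=\lambda(A\triangle B)+\rho(f,g)$. If, in addition, $(\mathcal F,\rho)$ is totally bounded, then convergence of the finite-dimensional marginals of $\mathbb Z_n^s$ to those of a tight Borel measurable limit implies weak convergence in $\ell^\infty(\mathcal A\times\mathcal F)$.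
   Context: Let $(\Omega,\Upsilon,P)$ be a probability space, $(\mathcal X,\mathcal A_{\mathcal X})$ a measurable space, $(X_{i,n})_{1\le i\le n,\,n\in\mathbb N}$ an array of $\mathcal X$-valued random variables, $\mathcal F$ a family of Borel measurable maps $\mathcal X\to\mathbb R$ with a finite measurable envelope $F$ ($\sup_f|f(x)|\le F(x)<\infty$, $\mathrm EF(X_{i,n})<\infty$). With $\lambda$ Lebesgue measure and $R_i=(i-1,i]$, $\mathbb Z_n^s(A,f)=n^{-1/2}\sum_{i=1}^n\lambda(R_i\cap nA)(f(X_{i,n})-\mathrm Ef(X_{i,n}))$, viewed as a map into $\ell^\infty(\mathcal A\times\mathcal F)$. $\mathcal F_\delta=\{f-g:f,g\in\mathcal F,\rho(f,g)\le\delta\}$; $Z^o_{k,n}(g)=g(X_{k,n})-\mathrm Eg(X_{k,n})$; $S^{Z^o}_{n,i,j}(g)=\sum_{k=i}^jZ^o_{k,n}(g)$. $\mathrm E^*$, $P^*$ outer expectation/probability. Condition (S): $(\alpha,g)$, $g:\mathbb N\to\mathbb R$, fulfills (S) with index $Q\in[1,2^{(\alpha-1)/\alpha})$ if $g\ge0$, $g$ nondecreasing, $g(i)+g(j-i)\le Qg(j)$ for all $1\le i<j$. (AEC) for $\tau$: for every $\varepsilon>0$, $\lim_{\delta\downarrow0}\limsup_nP^*(\sup_{\tau((A,f),(B,g))\le\delta}|\mathbb Z_n^s(A,f)-\mathbb Z_n^s(B,g)|>\varepsilon)=0$. Weak convergence is in the Hoffmann-Jørgensen sense ($\mathrm E^*h(\mathbb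 Z_n^s)\to\mathrm Eh(\mathbb Z^s)$ for bounded continuous $h$). *)

(* Defs.v *)
From HB Require Import structures.
From mathcomp Require Import all_boot all_order all_algebra.
From mathcomp Require Import all_classical all_reals all_analysis.
From mathcomp Require Import measurable_realfun.
Set Implicit Arguments. Unset Strict Implicit. Unset Printing Implicit Defensive.
Import Order.TTheory GRing.Theory Num.Theory.
Import numFieldNormedType.Exports.
Local Open Scope classical_set_scope.
Local Open Scope ring_scope.

Section Defs.
Context {R : realType}.

Definition outer_expect {d} {T : measurableType d} (P : probability T R)
  (Y : T -> \bar R) : \bar R :=
  ereal_inf [set (\int[P]_w U w)%E | U in
    [set U : T -> \bar R | [/\ measurable_fun [set: T] (U : T -> \bar R),
        (forall w, (Y w <= U w)%E) &
        ((\int[P]_w (U^\+ w) < +oo)%E \/ (\int[P]_w (U^\- w) < +oo)%E)]]].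

Definition outer_prob {d} {T : measurableType d} (P : probability T R)
  (B : set T) : \bar R :=
  ereal_inf [set P A | A in [set A | measurable A /\ B `<=` A]].

Definition condS (alpha : R) (g : nat -> R) (Q : R) : Prop :=
  [/\ 1 <= Q, Q < 2 `^ ((alpha - 1) / alpha),
      (forall n, (0 < n)%N -> 0 <= g n),
      (forall m n, (0 < m)%N -> (m <= n)%N -> g m <= g n) &
      (forall i j, (1 <= i)%N -> (i < j)%N -> g i + g (j - i)%N <= Q * g j)].

Definition semimetric_on {Xs : Type} (Fam : set (Xs -> R))
  (rho : (Xs -> R) -> (Xs -> R) -> R) : Prop :=
  forall f g k, Fam f -> Fam g -> Fam k ->
    [/\ 0 <= rho f g, rho f f = 0, rho f g = rho g f &
        rho f k <= rho f g + rho g k].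

Definition totally_bounded_on {Xs : Type} (Fam : set (Xs -> R))
  (rho : (Xs -> R) -> (Xs -> R) -> R) : Prop :=
  forall e : R, 0 < e -> exists G : set (Xs -> R),
    [/\ finite_set G, G `<=` Fam &
        forall f, Fam f -> exists2 k, G k & rho f k < e].

Definition Fdelta {Xs : Type} (Fam : set (Xs -> R))
  (rho : (Xs -> R) -> (Xs -> R) -> R) (delta : R) : set (Xs -> R) :=
  [set k | exists f g, [/\ Fam f, Fam g, rho f g <= delta & k = f \- g]].

Definition Zo {d dX} {T : measurableType d} {Xs : measurableType dX}
  (P : probability T R) (X : nat -> nat -> T -> Xs) (n k : nat)
  (f : Xs -> R) (w : T) : R :=
  f (X k n w) - fine (\int[P]_v (f (X k n v))%:E).

Definition Ssum {d dX} {T : measurableType d} {Xs : measurableType dX}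
  (P : probability T R) (X : nat -> nat -> T -> Xs) (n i j : nat)
  (f : Xs -> R) (w : T) : R :=
  \sum_(i <= k < j.+1) Zo P X n k f w.

Definition leb (A : set R) : R := fine ((@lebesgue_measure R) A).

Definition Rint (i : nat) : set R := [set` `](i%:R - 1), i%:R]].

Definition Aclass : set (set R) :=
  [set A | exists u v : R, [/\ 0 <= u, u <= v, v <= 1 & A = [set` `]u, v]]]].

Definition Zs {d dX} {T : measurableType d} {Xs : measurableType dX}
  (P : probability T R) (X : nat -> nat -> T -> Xs) (n : nat)
  (Af : set R * (Xs -> R)) (w : T) : R :=
  (Num.sqrt n%:R)^-1 *
    \sum_(1 <= i < n.+1)
       leb (Rint i `&` [set n%:R * x | x in Af.1]) * Zo P X n i Af.2 w.

Definition Tset {Xs : Type} (Fam : set (Xs -> R)) : set (set R * (Xs -> R)) :=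
  [set p | Aclass p.1 /\ Fam p.2].

Definition tau {Xs : Type} (rho : (Xs -> R) -> (Xs -> R) -> R)
  (p q : set R * (Xs -> R)) : R :=
  leb ((p.1 `\` q.1) `|` (q.1 `\` p.1)) + rho p.2 q.2.

Definition AEC {d dX} {T : measurableType d} {Xs : measurableType dX}
  (P : probability T R) (X : nat -> nat -> T -> Xs) (Fam : set (Xs -> R))
  (rho : (Xs -> R) -> (Xs -> R) -> R) : Prop :=
  forall e : R, 0 < e ->
    (limn_esup (fun n => outer_prob P
        [set w | (e%:E < ereal_sup
            [set `|Zs P X n st.1 w - Zs P X n st.2 w|%:E | st in
               [set st | [/\ Tset Fam st.1, Tset Fam st.2 &
                             (tau rho st.1 st.2 <= delta)%R]]])%E]))
      @[delta --> 0^'+] --> 0%E.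

Definition Tidx {Xs : Type} (Fam : set (Xs -> R)) :=
  {p : set R * (Xs -> R) | p \in Tset Fam}.

Definition linf (I : Type) : set (I -> R) :=
  [set x | exists M : R, forall t, `|x t| <= M].
Arguments linf I : clear implicits.

Definition supdist {I : Type} (x y : I -> R) : \bar R :=
  ereal_sup (range (fun t => (`|x t - y t|)%:E)).

Definition linf_open (I : Type) (O : set (I -> R)) : Prop :=
  O `<=` linf I /\
  forall x, O x -> exists2 r : R, 0 < r &
    forall y, linf I y -> (supdist x y < r%:E)%E -> O y.
Arguments linf_open I : clear implicits.

Definition linf_compact (I : Type) (K : set (I -> R)) : Prop :=
  K `<=` linf I /\
  forall C : set (set (I -> R)), C `<=` linf_open I ->
    K `<=` \bigcup_(O in C) O ->
    exists2 D : set (set (I -> R)), finite_set D &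
      D `<=` C /\ K `<=` \bigcup_(O in D) O.
Arguments linf_compact I : clear implicits.

Definition linf_continuous (I : Type) (hh : (I -> R) -> R) : Prop :=
  forall x, linf I x -> forall e : R, 0 < e -> exists2 r : R, 0 < r &
    forall y, linf I y -> (supdist x y < r%:E)%E -> `|hh x - hh y| < e.
Arguments linf_continuous I : clear implicits.

Definition linf_borel (I : Type) : set (set (I -> R)) :=
  <<s (linf I), linf_open I >>.
Arguments linf_borel I : clear implicits.

Definition borel_linf {d} {T : measurableType d} (I : Type)
  (Z : T -> I -> R) : Prop :=
  (forall w, linf I (Z w)) /\
  forall B, linf_borel I B -> measurable (Z @^-1` B).

Definition tight_linf {d} {T : measurableType d} (P : probability T R)
  (I : Type) (Z : T -> I -> R) : Prop :=
  forall e : R, 0 < e -> exists K : set (I -> R),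
    linf_compact I K /\ ((1 - e)%:E <= P (Z @^-1` K))%E.

Definition fidi_conv {d d'} {T : measurableType d} {T' : measurableType d'}
  (P : probability T R) (P' : probability T' R) (I : Type)
  (Zn : nat -> T -> I -> R) (Z : T' -> I -> R) : Prop :=
  forall (k : nat) (t : 'I_k -> I) (phi : 'rV[R]_k -> R),
    continuous phi -> (exists M : R, forall v, `|phi v| <= M) ->
    (fun n => \int[P]_w (phi (\row_i Zn n w (t i)))%:E)%E @ \oo -->
      (\int[P']_w (phi (\row_i Z w (t i)))%:E)%E.

(* weak convergence in l^infty(I) in the Hoffmann-Jorgensen sense *)
Definition weak_conv_linf {d d'} {T : measurableType d} {T' : measurableType d'}
  (P : probability T R) (P' : probability T' R) (I : Type)
  (Zn : nat -> T -> I -> R) (Z : T' -> I -> R) : Prop :=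
  forall hh : (I -> R) -> R,
    linf_continuous I hh ->
    (exists M : R, forall x, linf I x -> `|hh x| <= M) ->
    (fun n => outer_expect P (fun w => (hh (Zn n w))%:E)) @ \oo -->
      (\int[P']_w (hh (Z w))%:E)%E.

Definition ZsT {d dX} {T : measurableType d} {Xs : measurableType dX}
  (P : probability T R) (X : nat -> nat -> T -> Xs) (Fam : set (Xs -> R))
  (n : nat) (w : T) : Tidx Fam -> R :=
  fun t => Zs P X n (sval t) w.

End Defs.
Arguments ZsT {R d dX T Xs} P X Fam n w _.

(* Main.v *)
(* The oscillation of the smoothed process splits into a change of function over
   a fixed set and a change of set for a fixed function. As the process is a
   piecewise linear interpolation of partial sums, the first part is bounded by
   the maximal partial sum over F_delta, and the second one by the maximal
   partial sums over at most 2/delta blocks of length about 2 n delta. A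
   Moricz-type maximal inequality, proved by bisecting the index interval and
   using condition (S), bounds their nu-th outer moments by constants times
   g^(nu/2)(n, delta) and (2/delta) h^(nu/2)(2 n delta); after normalization,
   (3) and (4) make both vanish in the limit since nu > 2.

   For weak convergence, a finite net reduces Lipschitz functionals of the
   process to its marginals. The corresponding discretization error for the
   limit process is controlled by tightness: on a compact set of paths, finitely
   many indices witness the oscillation, and these are handled by the marginals.
   A bounded continuous functional is squeezed between Lipschitz ones by inf-
   and sup-convolution. *)
Require Import Defs.
From HB Require Import structures.
From mathcomp Require Import all_boot all_order all_algebra.
From mathcomp Require Import all_classical all_reals all_analysis.
From mathcomp Require Import measurable_realfun.
From mathcomp Require Import ring lra zify.
Import Order.TTheory GRing.Theory Num.Theory.
Import numFieldNormedType.Exports.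
Local Open Scope classical_set_scope.
Local Open Scope ring_scope.
Set Implicit Arguments.
Unset Strict Implicit.

(** Suprema over [Fam] and [Fdelta] need not be measurable, and the infimum in [outer_expect] need
    not be attained. Moments are therefore carried by measurable majorants with arbitrarily small
    slack, which turn pathwise inequalities between upper bounds into inequalities between moments;
    the bisection and Markov's inequality both run on this. The constant of the maximal inequality
    depends only on [nu] and the index [Q], so that one index for all radii delta makes it uniform
    in delta. The union bound over blocks costs a factor 2/delta against a normalized moment of
    order delta^(nu/2), which leaves delta^(nu/2-1). For the limit process, convergence of marginals
    sees finitely many indices and continuous test functions only. Hence the finite families
    extracted by compactness, and hence the gaps between the levels [e], [2 * e] and [3 * e]: they
    leave room for a cut-off function and for an open condition. *)

(** * Measurable majorants, outer expectation and outer probability *)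

Section Majorization.
Context {R : realType} {d : measure_display} {T : measurableType d}.
Variable P : probability T R.

(* The outer expectation of the supremum of [B w] is at most [c]; an empty
   [B w], whose supremum is [-oo] in the extended reals, counts as [0]. *)
Definition majorizable (B : T -> set R) (c : R) : Prop :=
  forall eta : R, 0 < eta -> exists U : T -> \bar R,
    [/\ measurable_fun [set: T] U, (forall w, (0 <= U w)%E),
        (forall w x, B w x -> (x%:E <= U w)%E) &
        (\int[P]_w U w <= (c + eta)%:E)%E].

(** A competitor nearly attaining the infimum is automatically nonnegative, because it dominates one
    nonnegative [phi f0]. For empty [G] the supremum is [-oo] and the hypothesis carries no
    information; there the zero majorant and [0 <= c] do. *)
Lemma outer_expect_majorizable (J : Type) (G : set J) (phi : J -> T -> R)
    (c : R) :
  0 <= c -> (forall f w, 0 <= phi f w) ->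
  (outer_expect P (fun w => ereal_sup [set (phi f w)%:E | f in G])
     <= c%:E)%E ->
  majorizable (fun w => [set phi f w | f in G]) c.
Proof.
move=> c0 phi0 hc eta eta0.
have [[f0 Gf0]|G0] := pselect (exists f, G f); last first.
  exists (fun=> 0%E); split => //.
    by move=> w x [f Gf _]; exfalso; apply: G0; exists f.
  by rewrite integral0 lee_fin addr_ge0// ltW.
have : (outer_expect P (fun w => ereal_sup [set (phi f w)%:E | f in G])
     < (c + eta)%:E)%E.
  by apply: le_lt_trans hc _; rewrite lte_fin ltrDl.
move=> /ereal_inf_lt [_ [U [mU YU _] <-] Uc].
exists U; split => //; last exact: ltW.
- move=> w; apply: le_trans (YU w).
  apply: (@le_trans _ _ (phi f0 w)%:E); first by rewrite lee_fin.
  by apply: ereal_sup_ubound; exists f0.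
- move=> w _ [f Gf <-]; apply: le_trans (YU w).
  by apply: ereal_sup_ubound; exists f.
Qed.

(** The slack [eta / (a + b)] granted to each majorant adds up to [eta] after weighting. Real bounds
    suffice in the pathwise hypothesis: where one majorant is [+oo], so is the combination, as [a]
    and [b] are positive. *)
Lemma majorizable_comb (B B1 B2 : T -> set R) (a b c1 c2 c : R) :
  0 < a -> 0 < b -> a * c1 + b * c2 <= c ->
  majorizable B1 c1 -> majorizable B2 c2 ->
  (forall w u1 u2, 0 <= u1 -> 0 <= u2 -> ubound (B1 w) u1 ->
     ubound (B2 w) u2 -> ubound (B w) (a * u1 + b * u2)) ->
  majorizable B c.
Proof.
move=> a0 b0 hc m1 m2 hB eta eta0.
have ab0 : 0 < a + b by rewrite addr_gt0.
have e0 : 0 < eta / (a + b) by rewrite divr_gt0.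
have [U1 [mU1 U10 U1B U1c]] := m1 _ e0.
have [U2 [mU2 U20 U2B U2c]] := m2 _ e0.
exists (fun w => (a%:E * U1 w + b%:E * U2 w)%E); split.
- by apply: emeasurable_funD; exact: measurable_funeM.
- by move=> w; rewrite adde_ge0// mule_ge0// lee_fin ltW.
- move=> w x Bx.
  move: (U10 w) (U20 w) (U1B w) (U2B w).
  case: (U1 w) => [u1| |] // u10; case: (U2 w) => [u2| |] // u20 h1 h2.
  + rewrite -!EFinM -EFinD lee_fin; exact: (hB w u1 u2).
  + have -> : (b%:E * +oo = +oo)%E by rewrite gt0_muley// lte_fin.
    by rewrite -EFinM addey// leey.
  + have -> : (a%:E * +oo = +oo)%E by rewrite gt0_muley// lte_fin.
    by rewrite -EFinM addye// leey.
  + by rewrite !gt0_muley ?lte_fin// leey.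
- rewrite ge0_integralD//; last 4 first.
  + by move=> w _; rewrite mule_ge0// lee_fin ltW.
  + exact: measurable_funeM.
  + by move=> w _; rewrite mule_ge0// lee_fin ltW.
  + exact: measurable_funeM.
  rewrite !ge0_integralZl_EFin ?(ltW a0) ?(ltW b0)//.
  apply: (@le_trans _ _ (a%:E * (c1 + eta / (a + b))%:E +
                         b%:E * (c2 + eta / (a + b))%:E)%E).
    by rewrite leeD// lee_pmul2l ?lte_fin.
  rewrite -!EFinM -EFinD lee_fin.
  have -> : a * (c1 + eta / (a + b)) + b * (c2 + eta / (a + b)) =
    a * c1 + b * c2 + eta by field; rewrite gt_eqF.
  by rewrite lerD2r.
Qed.

Lemma majorizable0 : majorizable (fun=> set0) 0.
Proof.
move=> eta eta0; exists (fun=> 0%E); split => //.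
by rewrite integral0 lee_fin add0r ltW.
Qed.

(** Majorants are nonnegative, so only the positive elements of [B'] have to be compared. *)
Lemma majorizable_le (B B' : T -> set R) (c c' : R) :
  c <= c' -> (forall w x, 0 < x -> B' w x -> B w x) ->
  majorizable B c -> majorizable B' c'.
Proof.
move=> cc' BB' m; apply: (@majorizable_comb _ B (fun=> set0) 1 1 c 0) => //.
- by rewrite !mul1r addr0.
- exact: majorizable0.
- move=> w u1 u2 u10 u20 h1 _ x B'x; rewrite !mul1r.
  have [x0|x0] := ltP 0 x; last by apply: le_trans x0 _; rewrite addr_ge0.
  by apply: (@le_trans _ _ u1); [exact: h1 (BB' _ _ _ _)|rewrite lerDl].
Qed.

Lemma majorizableU (B1 B2 : T -> set R) (c1 c2 : R) :
  majorizable B1 c1 -> majorizable B2 c2 ->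
  majorizable (fun w => B1 w `|` B2 w) (c1 + c2).
Proof.
move=> m1 m2; apply: (@majorizable_comb _ B1 B2 1 1 c1 c2) => //.
  by rewrite !mul1r.
move=> w u1 u2 u10 u20 h1 h2 x; rewrite !mul1r => -[/h1|/h2] h.
  by apply: le_trans h _; rewrite lerDl.
by apply: le_trans h _; rewrite lerDr.
Qed.

Lemma majorizable_bigcup (B : nat -> T -> set R) (c : R) (K : nat) :
  (forall k, (k < K)%N -> majorizable (B k) c) ->
  majorizable (fun w => \bigcup_(k in `I_K) B k w) (K%:R * c).
Proof.
elim: K => [|K IH] hB.
  rewrite mul0r; apply: majorizable_le majorizable0 => // w x _ [k] /=.
  by rewrite ltn0.
rewrite -natr1 mulrDl mul1r.
have IH' : majorizable (fun w => \bigcup_(k in `I_K) B k w) (K%:R * c).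
  by apply: IH => k kK; apply: hB; rewrite ltnW// ltnS.
apply: majorizable_le (majorizableU IH' (hB K (ltnSn K))) => //.
move=> w x _ [k /= kK Bk].
move: kK; rewrite ltnS leq_eqVlt => /orP[/eqP kK|kK].
  by right; rewrite -kK.
by left; exists k.
Qed.

Lemma outer_prob_le (A B : set T) :
  measurable A -> B `<=` A -> (outer_prob P B <= P A)%E.
Proof. by move=> mA BA; apply: ereal_inf_lbound; exists A. Qed.

Lemma outer_prob_ge0 (B : set T) : (0 <= outer_prob P B)%E.
Proof. by apply: le_ereal_inf_tmp => _ [A _ <-]. Qed.

Lemma outer_prob_mono (B1 B2 : set T) : B1 `<=` B2 ->
  (outer_prob P B1 <= outer_prob P B2)%E.
Proof.
move=> B12; apply: ereal_inf_le_tmp => _ [A [mA BA] <-]; exists A => //.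
by split => //; exact: subset_trans BA.
Qed.

(** The set where a majorant reaches [a] is measurable and contains [S], so Markov's inequality for
    the majorant bounds the outer probability. The slack [eta * a] becomes [eta] after division by
    [a]. *)
Lemma majorizable_markov (B : T -> set R) (c a : R) (S : set T) :
  0 < a -> majorizable B c -> (forall w, S w -> exists2 x, B w x & a <= x) ->
  (outer_prob P S <= (c / a)%:E)%E.
Proof.
move=> a0 m hS; apply/lee_addgt0Pr => eta eta0.
have ea0 : 0 < eta * a by rewrite mulr_gt0.
have [U [mU U0 UB Uc]] := m _ ea0.
have mA : measurable ([set: T] `&` [set w | (a%:E <= U w)%E]).
  exact: emeasurable_fun_c_infty.
apply: (@le_trans _ _ (P ([set: T] `&` [set w | (a%:E <= U w)%E]))).
  apply: outer_prob_le => // w Sw; split => //=.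
  have [x Bx ax] := hS w Sw.
  by apply: (@le_trans _ _ x%:E); [rewrite lee_fin|exact: UB].
have aP : (a%:E * P ([set: T] `&` [set w | (a%:E <= U w)%E]) <=
           (c + eta * a)%:E)%E.
  apply: le_trans Uc.
  have := @le_integral_comp_abse _ T R P setT measurableT U a id.
  move=> /(_ (@measurable_id _ _ _))/(_ (fun r r0 => r0)).
  move=> /(_ (fun x y _ _ xy => xy))/(_ mU)/(_ a0).
  have -> : [set x | (a%:E <= `|U x|)%E] = [set w | (a%:E <= U w)%E].
    by apply/funext => w /=; rewrite gee0_abs.
  move=> /le_trans; apply.
  by under eq_integral do rewrite gee0_abs//.
rewrite -EFinD.
have -> : c / a + eta = a^-1 * (c + eta * a) by field; rewrite gt_eqF.
by rewrite EFinM lee_pdivlMl.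
Qed.

Lemma outer_prob_subU (S S1 S2 : set T) : S `<=` S1 `|` S2 ->
  (outer_prob P S <= outer_prob P S1 + outer_prob P S2)%E.
Proof.
move=> hS; apply/lee_addgt0Pr => eta eta0.
(* Outer probabilities are at most 1, hence finite; only then does adding [eta / 2] increase them
   strictly. *)
have fin B : (outer_prob P B \is a fin_num).
  rewrite ge0_fin_numE ?outer_prob_ge0//.
  apply: (@le_lt_trans _ _ 1%E); last exact: ltry.
  rewrite -(@probability_setT _ _ _ P); exact: outer_prob_le.
have e20 : 0 < eta / 2 by rewrite divr_gt0.
have ap B : (outer_prob P B < outer_prob P B + (eta / 2)%:E)%E.
  by rewrite lteDl ?fin// lte_fin.
have [_ [A1 [mA1 SA1] <-] h1] := ereal_inf_lt (ap S1).
have [_ [A2 [mA2 SA2] <-] h2] := ereal_inf_lt (ap S2).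
apply: (@le_trans _ _ (P (A1 `|` A2))).
  apply: outer_prob_le; first exact: measurableU.
  by apply: subset_trans hS _; exact: setUSS.
apply: le_trans (measureU2 _ mA1 mA2) _.
apply: le_trans (leeD (ltW h1) (ltW h2)) _.
rewrite addeACA -EFinD.
have -> : eta / 2 + eta / 2 = eta by field.
by [].
Qed.

End Majorization.

(** * A maximal inequality for partial sums under condition (S) *)

Section Maximal.
Context {R : realType}.

Lemma powR_le (x y r : R) : 0 <= r -> 0 <= x -> x <= y -> x `^ r <= y `^ r.
Proof.
move=> r0 x0 xy; apply: ge0_ler_powR => //; rewrite nnegrE//.
exact: le_trans xy.
Qed.

(** The weight of [y] can be as close to 1 as desired if that of [x] may be large. With [c] the
    [nu]-th root of [b], either [x <= (c - 1) * y] and the sum is at most [c * y], or [y] is at most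
    [x / (c - 1)]. *)
Lemma powRD_le (nu b : R) : 0 < nu -> 1 < b -> exists2 a : R, 1 <= a &
  forall x y : R, 0 <= x -> 0 <= y ->
    (x + y) `^ nu <= a * x `^ nu + b * y `^ nu.
Proof.
move=> nu0 b1; have b0 : 0 < b by apply: lt_trans b1.
pose c := b `^ nu^-1.
have cnu : c `^ nu = b.
  by rewrite /c -powRrM mulVf ?gt_eqF// powRr1// ltW.
have c0 : 0 < c by rewrite powR_gt0.
have c1 : 1 < c.
  rewrite ltNge; apply/negP => cle.
  have := powR_le (ltW nu0) (ltW c0) cle.
  by rewrite cnu powR1 leNgt b1.
have c10 : 0 < c - 1 by rewrite subr_gt0.
have d1 : 1 <= 1 + (c - 1)^-1 by rewrite lerDl invr_ge0 ltW.
exists ((1 + (c - 1)^-1) `^ nu).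
  have {1}-> : (1 : R) = 1 `^ nu by rewrite powR1.
  by apply: powR_le; rewrite ?(ltW nu0).
move=> x y x0 y0.
have [xy|yx] := leP x ((c - 1) * y).
  apply: (@le_trans _ _ (b * y `^ nu)); last first.
    by rewrite lerDr mulr_ge0// powR_ge0.
  rewrite -cnu -powRM ?(ltW c0)//; apply: powR_le; rewrite ?(ltW nu0)//.
    exact: addr_ge0.
  lra.
apply: (@le_trans _ _ ((1 + (c - 1)^-1) `^ nu * x `^ nu)); last first.
  by rewrite lerDl mulr_ge0 ?(ltW b0)// powR_ge0.
rewrite -powRM//; last by rewrite (le_trans _ d1).
apply: powR_le; rewrite ?(ltW nu0) ?addr_ge0//.
rewrite mulrDl mul1r lerD2l mulrC ler_pdivlMr// mulrC; exact: ltW.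
Qed.

Context {d : measure_display} {T : measurableType d}.
Variable P : probability T R.

Definition psum {J : Type} (z : nat -> J -> T -> R) (i j : nat) (f : J) (w : T)
  : R := \sum_(i <= k < j.+1) z k f w.

Lemma psum_split {J : Type} (z : nat -> J -> T -> R) (i p k : nat) f w :
  (i <= p)%N -> (p <= k)%N ->
  psum z i k f w = psum z i p f w + psum z p.+1 k f w.
Proof.
move=> ip pk; rewrite /psum (@big_cat_nat _ _ _ p.+1)//=.
  by rewrite ltnW// ltnS.
Qed.

Definition running_moments {J : Type} (G : set J) (z : nat -> J -> T -> R) (nu : R)
  (i j : nat) (w : T) : set R :=
  [set x | exists f k, [/\ G f, (i <= k <= j)%N & x = `|psum z i k f w| `^ nu]].

(* With [q := 2 (Q / 2) ^ (nu / 2)], condition (S) says exactly [q < 1], so the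
   constant [b = 2 / (1 + q)] of [powRD_le] satisfies [b q < 1] and the
   recursion [A = a + b q A] obtained by bisection is solvable. *)
Lemma moricz_inequality (nu Q : R) :
  2 < nu -> 1 <= Q -> Q < 2 `^ ((nu / 2 - 1) / (nu / 2)) ->
  exists2 A : R, 0 <= A &
  forall (J : Type) (G : set J) (z : nat -> J -> T -> R) (g : nat -> R)
    (n : nat),
  condS (nu / 2) g Q ->
  (forall i j, (1 <= i)%N -> (i <= j <= n)%N ->
    majorizable P (fun w => [set `|psum z i j f w| `^ nu | f in G])
      (g (j - i + 1)%N `^ (nu / 2))) ->
  forall i j, (1 <= i)%N -> (i <= j <= n)%N ->
    majorizable P (running_moments G z nu i j) (A * g (j - i + 1)%N `^ (nu / 2)).
Proof.
move=> nu2 Q1 Q2.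
set al := nu / 2 in Q2 *.
have al1 : 1 < al by rewrite /al ltr_pdivlMr// mul1r.
have al0 : 0 < al by apply: lt_trans al1.
have nu0 : 0 < nu by apply: lt_trans nu2.
have Q0 : 0 < Q by apply: lt_le_trans Q1.
have Qh0 : 0 <= Q / 2 by rewrite divr_ge0// ltW.
pose q := 2 * (Q / 2) `^ al.
have Qp0 : 0 < (Q / 2) `^ al by rewrite powR_gt0// divr_gt0.
have q0 : 0 < q by rewrite /q mulr_gt0.
have q1 : q < 1.
  rewrite /q powRM ?ltW// ?invr_ge0//.
  have : Q `^ al < 2 `^ (al - 1).
    have -> : (2 : R) `^ (al - 1) = (2 `^ ((al - 1) / al)) `^ al.
      by rewrite -powRrM divfK// gt_eqF.
    by apply: gt0_ltr_powR => //; rewrite nnegrE ?ltW// powR_ge0.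
  have -> : (2^-1 : R) `^ al = (2 `^ al)^-1 by rewrite -powR_inv1// -powRrM mulN1r powRN.
  have -> : (2 : R) `^ al = 2 * 2 `^ (al - 1) by rewrite mulr_powRB1.
  have : (0 : R) < 2 `^ (al - 1) by rewrite powR_gt0.
  move: (2 `^ (al - 1)) (Q `^ al) => X Y X0 YX.
  have -> : 2 * (Y * (2 * X)^-1) = Y / X by field; rewrite gt_eqF.
  by rewrite ltr_pdivrMr// mul1r.
have q10 : 0 < 1 + q by rewrite addr_gt0.
pose b := 2 / (1 + q).
have b1 : 1 < b by rewrite /b ltr_pdivlMr// mul1r; lra.
have b0 : 0 < b by apply: lt_trans b1.
have bq : b * q < 1.
  by rewrite /b mulrAC ltr_pdivrMr// mul1r; lra.
have [a a1 hab] := powRD_le nu0 b1.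
have a0 : 0 < a by apply: lt_le_trans a1.
have bq0 : 0 < 1 - b * q by rewrite subr_gt0.
pose A := a / (1 - b * q).
have A0 : 0 <= A by rewrite divr_ge0 ?ltW.
have AE : a + b * (A * q) = A by rewrite /A; field; rewrite gt_eqF.
exists A => // J G z g n [_ _ g0 gmono gS] hmaj.
suff main : forall L i j, (j - i < L)%N -> (1 <= i)%N -> (i <= j <= n)%N ->
    majorizable P (running_moments G z nu i j) (A * g (j - i + 1)%N `^ al).
  by move=> i j i1 ij; apply: (main (j - i).+1 i j (ltnSn _)).
elim=> [//|L IH] i j jiL i1 /andP[ij jn].
set l := (j - i + 1)%N.
have l0 : (0 < l)%N by rewrite /l addn1.
(* If [g l] vanishes, no length up to [l] satisfies the strict inequality that selects [m] below.
   Monotonicity then makes every moment on the interval zero, and a union bound over the end points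
   suffices. *)
have [gl0|gl0] := leP (g l) 0.
  have z0 k : (0 < k)%N -> (k <= l)%N -> g k `^ al = 0.
    move=> k0 kl; have -> : g k = 0.
      by apply/eqP; rewrite eq_le g0// andbT; apply: le_trans gl0; exact: gmono.
    by rewrite powR0// gt_eqF.
  rewrite z0// mulr0.
  pose B k := fun w => [set `|psum z i (i + k) f w| `^ nu | f in G].
  have hB k : (k < l)%N -> majorizable P (B k) 0.
    move=> kl; rewrite -(z0 k.+1)//.
    have -> : k.+1 = (i + k - i + 1)%N by rewrite addKn addn1.
    apply: hmaj => //; by move: kl jn ij; rewrite /l; clear; lia.
  apply: majorizable_le (majorizable_bigcup hB); rewrite ?mulr0// => w x _.
  move=> [f [k [Gf ikj ->]]]; exists (k - i)%N => /=.
    by move: ikj; rewrite /l; clear; lia.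
  by exists f => //; rewrite subnKC//; case/andP: ikj.
(* [m] will be the least length at which [g] exceeds [Q / 2 * g l]. Minimality bounds [g (m - 1)] by
   [Q / 2 * g l], and (S) bounds [g (l - m)] by [Q * g l - g m], hence by the same value. So the
   pieces on either side of the index [p], when nonempty, both fall under the induction hypothesis
   with the gain [Q / 2]. *)
have exm : exists m, (0 < m)%N && (Q / 2 * g l < g m).
  exists l; rewrite l0/= gtr_pMl// ltr_pdivrMr// mul1r.
  apply: lt_le_trans Q2 _; rewrite -[leRHS]powRr1//.
  by rewrite ler_powR ?ler1n// ler_pdivrMr// mul1r lerBlDr lerDl.
case: (ex_minnP exm) => m /andP[m0 hm] mmin.
have ml : (m <= l)%N.
  apply: mmin; rewrite l0/= gtr_pMl// ltr_pdivrMr// mul1r.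
  apply: lt_le_trans Q2 _; rewrite -[leRHS]powRr1//.
  by rewrite ler_powR ?ler1n// ler_pdivrMr// mul1r lerBlDr lerDl.
have small k : (0 < k)%N -> g k <= Q / 2 * g l ->
    A * g k `^ al <= A * ((Q / 2) `^ al * g l `^ al).
  move=> k0 gk; rewrite ler_wpM2l// -powRM ?(ltW gl0)//.
  by apply: powR_le => //; [exact: ltW|exact: g0].
set p := (i + m - 1)%N.
have H0 : 0 <= A * ((Q / 2) `^ al * g l `^ al).
  by rewrite mulr_ge0// mulr_ge0// powR_ge0.
have m1 : majorizable P (fun w => [set `|psum z i p f w| `^ nu | f in G])
    (g l `^ al).
  have gm : g m `^ al <= g l `^ al.
    by apply: powR_le; [exact: ltW|exact: g0|exact: gmono].
  have pE : (p - i + 1)%N = m by move: m0; rewrite /p; clear; lia.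
  rewrite -pE in gm; apply: majorizable_le gm _ (hmaj i p i1 _) => //.
  by move: ml i1 ij jn m0; rewrite /p /l; clear; lia.
have m2 : majorizable P (running_moments G z nu i (p - 1))
    (A * ((Q / 2) `^ al * g l `^ al)).
  have [mE|mgt] := leqP m 1.
    apply: (majorizable_le H0 _ (majorizable0 P)) => w x _ [f [k [_ ik _]]].
    by move: ik mE m0 i1; rewrite /p; clear; lia.
  have gm1 : g (m - 1)%N <= Q / 2 * g l.
    rewrite leNgt; apply/negP => h.
    by have := mmin (m - 1)%N; rewrite h andbT; move: mgt; clear; lia.
  have m10 : (0 < m - 1)%N by move: mgt; clear; lia.
  have := small _ m10 gm1.
  have -> : (m - 1 = p - 1 - i + 1)%N by move: m10; rewrite /p; clear; lia.
  move=> gm; apply: majorizable_le gm _ (IH i (p - 1)%N _ i1 _) => //.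
    by move: mgt ml i1 ij jn m0 jiL; rewrite /p /l; clear; lia.
  by move: mgt ml i1 ij jn m0 jiL; rewrite /p /l; clear; lia.
have m3 : majorizable P (running_moments G z nu p.+1 j)
    (A * ((Q / 2) `^ al * g l `^ al)).
  have [lm|mltl] := leqP l m.
    apply: (majorizable_le H0 _ (majorizable0 P)) => w x _ [f [k [_ ik _]]].
    by move: ik lm i1 m0; rewrite /p /l; clear; lia.
  have glm : g (l - m)%N <= Q / 2 * g l.
    by have := gS m l m0 mltl; move: hm; clear; lra.
  have lm0 : (0 < l - m)%N by rewrite subn_gt0.
  have := small _ lm0 glm.
  have -> : (l - m = j - p.+1 + 1)%N.
    by move: mltl i1 m0; rewrite /p /l; clear; lia.
  move=> gm; apply: majorizable_le gm _ (IH p.+1 j _ _ _) => //.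
    by move: mltl i1 ij jn m0 jiL; rewrite /p /l; clear; lia.
  by move: mltl i1 ij jn m0 jiL; rewrite /p /l; clear; lia.
(* A sum ending before [p] belongs to the left piece; one ending at [p] is covered by the moment
   hypothesis; one ending later is the sum up to [p] plus a sum of the right piece, split with
   weights [a] and [b]. The union of the two pieces yields the factor 2 in [q]. *)
apply: (majorizable_comb a0 b0 _ m1 (majorizableU m2 m3)).
  rewrite -[in leRHS]AE /q le_eqVlt; apply/orP; left; apply/eqP; ring.
move=> w u1 u2 u10 u20 h1 h2 x [f [k [Gf /andP[ik kj] ->]]].
have [kp|kp] := ltnP k p.
  apply: (@le_trans _ _ u2); last first.
    apply: (@le_trans _ _ (b * u2)); first by rewrite ler_peMl// ltW.
    by rewrite lerDr mulr_ge0// ltW.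
  apply: h2; left; exists f, k; split => //.
  by rewrite ik/= subn1 -ltnS prednK//; apply: leq_ltn_trans kp.
have [kp'|kp'] := leqP k p.
  have -> : k = p by apply/eqP; rewrite eqn_leq kp kp'.
  apply: (@le_trans _ _ u1); last first.
    apply: (@le_trans _ _ (a * u1)); first by rewrite ler_peMl.
    by rewrite lerDl mulr_ge0// ltW.
  by apply: h1; exists f.
have ip : (i <= p)%N by move: m0; rewrite /p; clear; lia.
rewrite (psum_split z f w ip (ltnW kp')).
apply: (@le_trans _ _ ((`|psum z i p f w| + `|psum z p.+1 k f w|) `^ nu)).
  by apply: powR_le; [exact: ltW|exact: normr_ge0|exact: ler_normD].
apply: le_trans (hab _ _ (normr_ge0 _) (normr_ge0 _)) _.
apply: lerD.
  by apply: ler_wpM2l (ltW a0) _ _ _; apply: h1; exists f.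
apply: ler_wpM2l (ltW b0) _ _ _.
by apply: h2; right; exists f, k; split => //; rewrite kp' kj.
Qed.

End Maximal.

(** * The process as an increment of a piecewise linear path *)

Section Interpolation.
Context {R : realType}.

(** [clamp (t - i)] is the length of the part of the cell []i, i + 1]] to the left of [t], so the
    weight of an interval in a cell is a difference of two such values. *)
Definition clamp (x : R) : R := Num.min 1 (Num.max 0 x).

Lemma clampE (x : R) :
  [\/ x <= 0 /\ clamp x = 0, 0 <= x <= 1 /\ clamp x = x | 1 <= x /\ clamp x = 1].
Proof.
rewrite /clamp /Num.min /Num.max; case: ifPn; case: ifPn => h1 h2.
- by constructor 3; lra.
- by constructor 1; move: h1 h2; lra.
- by constructor 2; move: h1 h2; lra.
- by constructor 1; split => //; move: h1 h2; lra.
Qed.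

Lemma clamp_le0 (x : R) : x <= 0 -> clamp x = 0.
Proof. by case: (clampE x) => -[? ->]; lra. Qed.

Lemma clamp_ge1 (x : R) : 1 <= x -> clamp x = 1.
Proof. by case: (clampE x) => -[? ->]; lra. Qed.

Lemma leb_itv (a b : R) : a <= b -> leb [set` `]a, b]] = b - a.
Proof.
rewrite le_eqVlt => /orP[/eqP ->|ab]; rewrite /leb lebesgue_measure_itv/=.
  by rewrite ltxx subrr.
by rewrite lte_fin ab.
Qed.

Lemma leb_itv0 (a b : R) : b <= a -> leb [set` `]a, b]] = 0.
Proof. by move=> ba; rewrite /leb lebesgue_measure_itv/= lte_fin ltNge ba. Qed.

Lemma leb_cell (i : nat) (a b : R) : a <= b ->
  leb (Defs.Rint i.+1 `&` [set` `]a, b]]) = clamp (b - i%:R) - clamp (a - i%:R).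
Proof.
move=> ab; set x : R := i%:R.
have -> : Defs.Rint i.+1 `&` [set` `]a, b]] =
    [set` `]Num.max x a, Num.min (x + 1) b]].
  apply/seteqP; split => y /=; rewrite /Defs.Rint /= -(natr1 i) -/x !in_itv/=;
    rewrite gt_max le_min.
    by move=> [/andP[? ->] /andP[-> ->]]; rewrite !andbT; lra.
  by move=> /andP[/andP[? ?] /andP[? ?]]; split; apply/andP; split => //; lra.
have mE : Num.max x a = if x < a then a else x by [].
have ME : Num.min (x + 1) b = if x + 1 < b then x + 1 else b by [].
have [h|h] := leP (Num.max x a) (Num.min (x + 1) b).
  rewrite leb_itv//; move: h; rewrite mE ME.
  by case: ifPn => ?; case: ifPn => ?; case: (clampE (b - x)) => -[? ->];
    case: (clampE (a - x)) => -[? ->]; lra.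
rewrite leb_itv0 ?ltW//; move: h; rewrite mE ME.
by case: ifPn => ?; case: ifPn => ?; case: (clampE (b - x)) => -[? ->];
  case: (clampE (a - x)) => -[? ->]; lra.
Qed.

(** The continuous path through the partial sums of [z]. The shift in the index is there because the
    cell starting at [k] is [Rint k.+1]. *)
Definition interp (z : nat -> R) (n : nat) (t : R) : R :=
  \sum_(0 <= k < n) clamp (t - k%:R) * z k.+1.

Lemma interp_nat (z : nat -> R) (n j : nat) : (j <= n)%N ->
  interp z n j%:R = \sum_(1 <= k < j.+1) z k.
Proof.
move=> jn; rewrite /interp (@big_cat_nat _ _ _ j)//= [X in _ + X]big_nat.
rewrite [X in _ + X]big1 ?addr0; last first.
  by move=> k /andP[jk _]; rewrite clamp_le0 ?mul0r// subr_le0 ler_nat.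
rewrite big_add1/= !big_nat; apply: eq_bigr => k /andP[_ kj].
by rewrite clamp_ge1 ?mul1r// lerBrDr nat1r ler_nat.
Qed.

(** The kinks of [clamp] shifted by [i] lie at [i] and [i + 1], never strictly between [k] and
    [k + 1]. *)
Lemma clamp_affine (k i : nat) (th : R) : 0 <= th <= 1 ->
  clamp (k%:R + th - i%:R) =
  (1 - th) * clamp (k%:R - i%:R) + th * clamp (k.+1%:R - i%:R).
Proof.
move=> th01; have [ik|ki] := ltnP i k.
  have : (i%:R + 1 <= k%:R :> R) by rewrite natr1 ler_nat.
  rewrite -(natr1 k) => h.
  by rewrite !clamp_ge1; lra.
have [ik|ik] := ltnP k i.
  have : (k%:R + 1 <= i%:R :> R) by rewrite natr1 ler_nat.
  rewrite -(natr1 k) => h.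
  by rewrite !clamp_le0; lra.
have -> : i = k by apply/eqP; rewrite eqn_leq ki ik.
rewrite -(natr1 k).
have -> : k%:R + th - k%:R = th by ring.
have -> : (k%:R + 1 - k%:R : R) = 1 by ring.
rewrite subrr (@clamp_le0 0)// (@clamp_ge1 1)//.
by case: (clampE th) => -[? ->]; lra.
Qed.

Lemma interp_affine (z : nat -> R) (n k : nat) (th : R) : 0 <= th <= 1 ->
  interp z n (k%:R + th) =
  (1 - th) * interp z n k%:R + th * interp z n k.+1%:R.
Proof.
move=> th01; rewrite /interp !mulr_sumr -big_split/=.
by apply: eq_bigr => i _; rewrite clamp_affine//; ring.
Qed.

(* The interpolation is affine between integers, so its deviation from its
   value at [a] is controlled by the partial sums at integers. *)
Lemma interp_bound (z : nat -> R) (n a b : nat) (t M : R) :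
  0 <= M -> (a <= b)%N -> (b <= n)%N -> a%:R <= t -> t <= b%:R ->
  (forall j, (a < j)%N -> (j <= b)%N -> `|\sum_(a.+1 <= k < j.+1) z k| <= M) ->
  `|interp z n t - interp z n a%:R| <= M.
Proof.
move=> M0 ab bn at_ tb hM.
have vertex k : (a <= k)%N -> (k <= b)%N ->
    `|interp z n k%:R - interp z n a%:R| <= M.
  rewrite leq_eqVlt => /orP[/eqP <- _|ak kb]; first by rewrite subrr normr0.
  rewrite !interp_nat; try lia.
  rewrite (@big_cat_nat _ _ _ a.+1)/=; try lia.
  by rewrite addrAC subrr add0r; apply: hM.
have t0 : 0 <= t by apply: le_trans at_.
have /andP[kt tk] := truncn_itv t0; set k := Num.truncn t in kt tk.
have ak : (a <= k)%N by rewrite truncn_ge_nat.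
(* An integer [t] is treated apart: for [t = b] the next vertex [k.+1] would lie beyond [b]. *)
have [kt_eq|kneq] := eqVneq t k%:R.
  by rewrite kt_eq; apply: vertex => //; rewrite -(ler_nat R) -kt_eq.
have ktl : k%:R < t by rewrite lt_neqAle eq_sym kneq.
have kb : (k < b)%N by rewrite -(ltr_nat R); apply: lt_le_trans tb.
pose th := t - k%:R.
have th01 : 0 <= th <= 1.
  by rewrite /th; move: tk; rewrite -(natr1 k); lra.
have tE : t = k%:R + th by rewrite /th; ring.
rewrite tE interp_affine//.
have -> : (1 - th) * interp z n k%:R + th * interp z n k.+1%:R -
    interp z n a%:R = (1 - th) * (interp z n k%:R - interp z n a%:R) +
    th * (interp z n k.+1%:R - interp z n a%:R) by ring.
have v1 := vertex k ak (ltnW kb).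
have v2 := vertex k.+1 (leqW ak) kb.
apply: le_trans (ler_normD _ _) _; rewrite !normrM.
have -> : `|1 - th| = 1 - th by rewrite ger0_norm; lra.
have -> : `|th| = th by rewrite ger0_norm; lra.
have -> : M = (1 - th) * M + th * M by ring.
by apply: lerD; apply: ler_wpM2l => //; lra.
Qed.

Context {d dX : measure_display} {T : measurableType d}
  {Xs : measurableType dX}.
Variables (P : probability T R) (X : nat -> nat -> T -> Xs).

Lemma scale_itv (n : nat) (u v : R) : (0 < n)%N ->
  [set n%:R * x | x in [set` `]u, v]]] = [set` `](n%:R * u), (n%:R * v)]].
Proof.
move=> n0; have n0' : 0 < n%:R :> R by rewrite ltr0n.
apply/seteqP; split => y /=.
  by move=> [x /=]; rewrite !in_itv/= => /andP[ux xv] <-;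
    rewrite ltr_pM2l// ler_pM2l// ux.
rewrite in_itv/= => /andP[uy yv]; exists (y / n%:R); last first.
  by rewrite mulrC divfK// gt_eqF.
by rewrite /= in_itv/= ltr_pdivlMr// ler_pdivrMr// ![_ * n%:R]mulrC uy.
Qed.

(** This reduces the process indexed by sets to a path in one variable: only the end points of the
    interval matter. *)
Lemma ZsE (n : nat) (u v : R) f w : (0 < n)%N -> u <= v ->
  Zs P X n ([set` `]u, v]], f) w = (Num.sqrt n%:R)^-1 *
    (interp (fun k => Zo P X n k f w) n (n%:R * v) -
     interp (fun k => Zo P X n k f w) n (n%:R * u)).
Proof.
move=> n0 uv; rewrite /Zs scale_itv//=; congr (_ * _).
rewrite /interp -sumrB big_add1/=; apply: eq_bigr => k _.
by rewrite leb_cell ?ler_wpM2l// mulrBl.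
Qed.

End Interpolation.

(** * Upper limits, and limits at zero from the right *)

Section Limits.
Context {R : realType}.

Lemma limn_esup_lt (u : nat -> \bar R) (a : \bar R) :
  (limn_esup u < a)%E -> \forall n \near \oo, (u n < a)%E.
Proof.
move=> /ereal_inf_lt [_ [V FV <-] Va].
apply: filterS FV => n Vn; apply: le_lt_trans Va.
by apply: ereal_sup_ubound; exists n.
Qed.

Lemma limn_esup_le (u : nat -> \bar R) (a : \bar R) :
  (\forall n \near \oo, (u n <= a)%E) -> (limn_esup u <= a)%E.
Proof.
move=> h; apply: (@le_trans _ _ (ereal_sup [set u n | n in [set n | (u n <= a)%E]])).
  by apply: ereal_inf_lbound; exists [set n | (u n <= a)%E].
by apply: ge_ereal_sup => _ [n /= un <-].
Qed.

Lemma cvge0_le (F : set_system R) {FF : Filter F} (f : R -> \bar R) :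
  (forall x, (0 <= f x)%E) ->
  (forall eta : R, 0 < eta -> \forall x \near F, (f x <= eta%:E)%E) ->
  f x @[x --> F] --> 0%E.
Proof.
move=> f0 h A /nbhs_EFin /nbhs_ballP [e /= e0 eA].
have e20 : 0 < e / 2 by rewrite divr_gt0.
apply: filterS (h _ e20) => x fx /=.
have : f x \is a fin_num by rewrite ge0_fin_numE// (le_lt_trans fx)// ltry.
move: fx (f0 x); case: (f x) => // r; rewrite !lee_fin => re r0 _.
apply: eA; rewrite /ball/= sub0r normrN ger0_norm//.
by apply: le_lt_trans re _; rewrite ltr_pdivrMr// mulr2n mulrDr mulr1 ltrDl.
Qed.

Lemma near_right_powR_le (D r eta : R) : 0 < r -> 0 < eta ->
  \forall x \near (0:R)^'+, D * x `^ r <= eta.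
Proof.
move=> r0 eta0; have k0 : 0 < eta / (`|D| + 1) by rewrite divr_gt0// ltr_wpDl.
have := powR_cvg0 r0; move=> /cvgr0_norm_lt /(_ _ k0) h.
apply: filterS h => x hx; apply: (le_trans (ler_norm _)).
rewrite normrM; apply: (@le_trans _ _ ((`|D| + 1) * `|x `^ r|)).
  by rewrite ler_wpM2r// lerDl.
by rewrite mulrC -ler_pdivlMr ?ltr_wpDl// ltW.
Qed.

End Limits.

(** * Modulus of the interpolation, and symmetric differences of intervals *)

Section Modulus.
Context {R : realType}.

(** Two points at distance at most [m] lie in the same block of length [m] or in adjacent ones. At
    worst the path from [s] to [t] passes through the starts of both blocks, and each of the three
    legs costs [M]. *)
Lemma interp_modulus (z : nat -> R) (n m : nat) (M s t : R) :
  0 <= M -> (0 < m)%N ->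
  (forall k j, (k * m < j)%N -> (j <= k.+1 * m)%N -> (j <= n)%N ->
    `|\sum_((k * m).+1 <= i < j.+1) z i| <= M) ->
  0 <= s -> s <= t -> t <= n%:R -> t - s <= m%:R ->
  `|interp z n t - interp z n s| <= 3 * M.
Proof.
move=> M0 m0 hM s0 st tn tsm.
have m0' : 0 < m%:R :> R by rewrite ltr0n.
have block k x : (k * m)%:R <= x -> x <= (k.+1 * m)%:R -> x <= n%:R ->
    `|interp z n x - interp z n (k * m)%:R| <= M.
  move=> h1 h2 h3; apply: (@interp_bound _ _ _ _ (minn (k.+1 * m) n)) => //.
  - rewrite leq_min leq_mul2r leqnSn orbT/= -(ler_nat R).
    exact: le_trans h3.
  - exact: geq_minr.
  - by rewrite /minn; case: ifP.
  - move=> j kj; rewrite leq_min => /andP[jk jn]; exact: hM.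
have /andP[ks sk] := truncn_itv (divr_ge0 s0 (ltW m0')).
set k := Num.truncn (s / m%:R) in ks sk.
have {}ks : (k * m)%:R <= s by move: ks; rewrite ler_pdivlMr// natrM.
have {}sk : s <= (k.+1 * m)%:R.
  by move: sk; rewrite ltr_pdivrMr// natrM => /ltW.
have bs := block k s ks sk (le_trans st tn).
have [tk|kt] := leP t (k.+1 * m)%:R.
  have bt := block k t (le_trans ks st) tk tn.
  move: bs bt; rewrite !ler_norml => /andP[? ?] /andP[? ?].
  by apply/andP; split; lra.
have bk : `|interp z n (k.+1 * m)%:R - interp z n (k * m)%:R| <= M.
  apply: block => //; first exact: le_trans sk.
  exact: ltW (lt_le_trans kt tn).
have bt : `|interp z n t - interp z n (k.+1 * m)%:R| <= M.
  apply: block => //; first exact: ltW.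
  by move: sk tsm; rewrite mulSn natrD !mulSn !natrD; lra.
move: bs bt bk; rewrite !ler_norml => /andP[? ?] /andP[? ?] /andP[? ?].
by apply/andP; split; lra.
Qed.

(** If the intervals overlap, their symmetric difference contains the gap between the left end
    points and the gap between the right ones. If they are disjoint, it contains both intervals
    entirely, and their end points may be far apart. *)
Lemma leb_symdiff_ge (u v u' v' dl : R) : u <= v -> u' <= v' ->
  leb (([set` `]u, v]] `\` [set` `]u', v']]) `|`
       ([set` `]u', v']] `\` [set` `]u, v]])) <= dl ->
  (`|u - u'| <= dl /\ `|v - v'| <= dl) \/ (v - u <= dl /\ v' - u' <= dl).
Proof.
move=> uv uv'; set A := [set` `]u, v]]; set A' := [set` `]u', v']].
set S := (X in leb X) => Sdl.
have mS : measurable S.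
  by apply: measurableU; apply: measurableD; exact: measurable_itv.
pose lo := Num.min u u'; pose hi := Num.max v v'.
have low : lo <= u /\ lo <= u' by rewrite /lo; split; rewrite ge_min lexx ?orbT.
have hiv : v <= hi /\ v' <= hi by rewrite /hi; split; rewrite le_max lexx ?orbT.
(* [leb] goes through [fine], which sends [+oo] to 0, so comparing measures requires finiteness. *)
have finS : (lebesgue_measure S < +oo)%E.
  apply: (@le_lt_trans _ _ (lebesgue_measure [set` `]lo, hi]])).
    apply: le_measure; rewrite ?inE// => x /= [[]|[]];
      rewrite /A /A' /= !in_itv/= => /andP[? ?] _; apply/andP; split; lra.
  by rewrite lebesgue_measure_itv/=; case: ifP => _; rewrite ltry.
have sub a b : [set` `]a, b]] `<=` S -> b - a <= dl.
  move=> abS; have [ba|ab] := leP b a.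
    apply: le_trans Sdl; apply: (@le_trans _ _ 0); first by rewrite subr_le0.
    by apply: fine_ge0.
  apply: le_trans Sdl; rewrite -(leb_itv (ltW ab)) /leb; apply: fine_le.
  - rewrite ge0_fin_numE// lebesgue_measure_itv/=.
    by case: ifP => _; rewrite ltry.
  - by rewrite ge0_fin_numE.
  - by apply: le_measure; rewrite ?inE.
have [|dis] := ltP (Num.max u u') (Num.min v v').
  rewrite gt_max !lt_min => /andP[/andP[? ?] /andP[? ?]]; left.
  have H a b : (a = u /\ b = u') \/ (a = u' /\ b = u) -> b - a <= dl.
    move=> ab; apply: sub => x /=; rewrite in_itv/= /S /A /A' /= !in_itv/=.
    move=> /andP[ax xb]; case: ab => -[? ?]; subst a b; [left|right]; split.
    - by apply/andP; split; lra.
    - by apply/negP; rewrite negb_and -!leNgt xb.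
    - by apply/andP; split; lra.
    - by apply/negP; rewrite negb_and -!leNgt xb.
  have H' a b : (a = v /\ b = v') \/ (a = v' /\ b = v) -> b - a <= dl.
    move=> ab; apply: sub => x /=; rewrite in_itv/= /S /A /A' /= !in_itv/=.
    move=> /andP[ax xb]; case: ab => -[? ?]; subst a b; [right|left]; split.
    - by apply/andP; split; lra.
    - by apply/negP; rewrite negb_and -!ltNge ax orbT.
    - by apply/andP; split; lra.
    - by apply/negP; rewrite negb_and -!ltNge ax orbT.
  have := H u u'; have := H u' u; have := H' v v'; have := H' v' v.
  move=> /(_ (or_intror (conj erefl erefl))) ?.
  move=> /(_ (or_introl (conj erefl erefl))) ?.
  move=> /(_ (or_intror (conj erefl erefl))) ?.
  move=> /(_ (or_introl (conj erefl erefl))) ?.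
  by split; rewrite ler_norml; apply/andP; split; lra.
right; split; apply: sub => x /=; rewrite in_itv/= /S /A /A' /= !in_itv/=.
  move=> /andP[ux xv]; left; split; first by rewrite ux xv.
  move=> /andP[u'x xv']; move: dis; rewrite leNgt => /negP; apply.
  rewrite gt_max !lt_min; apply/andP; split; apply/andP; split; lra.
move=> /andP[ux xv]; right; split; first by rewrite ux xv.
move=> /andP[u'x xv']; move: dis; rewrite leNgt => /negP; apply.
rewrite gt_max !lt_min; apply/andP; split; apply/andP; split; lra.
Qed.

(** A point in exactly one of the intervals lies between the two left end points or between the two
    right ones. *)
Lemma leb_symdiff_le (u v u' v' : R) : u <= v -> u' <= v' ->
  leb (([set` `]u, v]] `\` [set` `]u', v']]) `|`
       ([set` `]u', v']] `\` [set` `]u, v]])) <= `|u - u'| + `|v - v'|.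
Proof.
move=> uv uv'; set S := (X in leb X).
have mS : measurable S.
  by apply: measurableU; apply: measurableD; exact: measurable_itv.
pose I1 : set R := [set` `]Num.min u u', Num.max u u']].
pose I2 : set R := [set` `]Num.min v v', Num.max v v']].
have SI : S `<=` I1 `|` I2.
  move=> x; rewrite /S /I1 /I2 /= !in_itv/= !gt_min !le_max.
  move=> [[/andP[h1 h2] /negP]|[/andP[h1 h2] /negP]]; rewrite negb_and -leNgt -ltNge.
    by move=> /orP[h|h]; [left|right]; rewrite ?h1 ?h2 ?h ?orbT.
  by move=> /orP[h|h]; [left|right]; rewrite ?h1 ?h2 ?h ?orbT.
have L (a b : R) : lebesgue_measure [set` `]Num.min a b, Num.max a b]] = `|a - b|%:E.
  rewrite lebesgue_measure_itv/= lte_fin.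
  have -> : `|a - b| = Num.max a b - Num.min a b.
    rewrite /Num.max /Num.min; case: ifPn => ab.
      by rewrite ltr0_norm ?subr_lt0// opprB.
    by rewrite ger0_norm// subr_ge0 leNgt.
  case: ifPn => //; rewrite -leNgt => h; congr (_%:E).
  have : Num.min a b <= Num.max a b by rewrite ge_min le_max lexx.
  by move: h; lra.
have h : (lebesgue_measure S <= (`|u - u'| + `|v - v'|)%:E)%E.
  rewrite EFinD -!L; apply: le_trans (measureU2 _ _ _) => //.
  by apply: le_measure; rewrite ?inE//; exact: measurableU.
rewrite -lee_fin /leb fineK// ge0_fin_numE//.
by apply: le_lt_trans h _; rewrite ltry.
Qed.

End Modulus.

(** * Asymptotic equicontinuity of the smoothed process *)

Section Equicontinuity.
Context {R : realType} {d dX : measure_display} {T : measurableType d}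
  {Xs : measurableType dX}.
Variables (P : probability T R) (X : nat -> nat -> T -> Xs).
Variables (Fam : set (Xs -> R)) (F : Xs -> R)
  (rho : (Xs -> R) -> (Xs -> R) -> R).
Hypothesis mX :
  forall i n, (1 <= i <= n)%N -> measurable_fun [set: T] (X i n).
Hypothesis mFam : forall f, Fam f -> measurable_fun [set: Xs] f.
Hypothesis mF : measurable_fun [set: Xs] F.
Hypothesis FamF : forall f x, Fam f -> `|f x| <= F x.
Hypothesis intF : forall i n, (1 <= i <= n)%N ->
  (\int[P]_w (F (X i n w))%:E < +oo)%E.

Lemma integrable_comp f k n : Fam f -> (1 <= k <= n)%N ->
  P.-integrable [set: T] (fun w => (f (X k n w))%:E).
Proof.
move=> Ff kn; have mk := mX kn.
have iF : P.-integrable [set: T] (fun w => (F (X k n w))%:E).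
  apply/integrableP; split.
    by apply/measurable_EFinP; apply: measurableT_comp.
  rewrite (eq_integral (fun w => (F (X k n w))%:E)) ?intF// => w _.
  by rewrite gee0_abs// lee_fin; apply: le_trans (FamF _ Ff).
apply: le_integrable iF => //.
  by apply/measurable_EFinP; apply: measurableT_comp => //; exact: mFam.
move=> w _; rewrite !abse_EFin lee_fin.
by apply: le_trans (FamF _ Ff) _; exact: ler_norm.
Qed.

Lemma Zo_sub f g k n w : Fam f -> Fam g -> (1 <= k <= n)%N ->
  Zo P X n k (f \- g) w = Zo P X n k f w - Zo P X n k g w.
Proof.
move=> Ff Fg kn; have fi := integrable_comp Ff kn.
have gi := integrable_comp Fg kn; rewrite /Zo /=.
under eq_integral do rewrite EFinB.
rewrite integralB_EFin// fineB ?integrable_fin_num//.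
by ring.
Qed.

Lemma Zs_sub f g A n w : Fam f -> Fam g ->
  Zs P X n (A, f) w - Zs P X n (A, g) w = Zs P X n (A, f \- g) w.
Proof.
move=> Ff Fg; rewrite /Zs -mulrBr -sumrB /= big_nat [in RHS]big_nat.
congr (_ * _); apply: eq_bigr => k kn; by rewrite Zo_sub// -mulrBr.
Qed.

Definition oscillation (n : nat) (dl e : R) : set T :=
  [set w | (e%:E < ereal_sup
    [set `|Zs P X n st.1 w - Zs P X n st.2 w|%:E | st in
      [set st | [/\ Tset Fam st.1, Tset Fam st.2 &
                    (tau rho st.1 st.2 <= dl)%R]]])%E].

Let z n : nat -> (Xs -> R) -> T -> R := fun k f w => Zo P X n k f w.

Lemma running_moments_le (G : set (Xs -> R)) nu n i j w M f k : 0 < nu -> 0 <= M ->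
  ~ (exists2 x, running_moments G (z n) nu i j w x & M `^ nu <= x) ->
  G f -> (i <= k <= j)%N -> `|psum (z n) i k f w| <= M.
Proof.
move=> nu0 M0 h Gf ikj; rewrite leNgt; apply/negP => hM; apply: h.
exists (`|psum (z n) i k f w| `^ nu); first by exists f, k.
by apply: powR_le; [exact: ltW| |exact: ltW].
Qed.

Hypothesis rho_semi : semimetric_on Fam rho.

Lemma oscillation_sub nu n m K dl e :
  0 < nu -> (0 < n)%N -> (0 < m)%N -> 0 < e -> dl * n%:R <= m%:R ->
  (n <= K * m)%N ->
  oscillation n dl e `<=`
    [set w | exists2 x, running_moments (Fdelta Fam rho dl) (z n) nu 1 n w x &
       (e * Num.sqrt n%:R / 4) `^ nu <= x] `|`
    [set w | exists2 x, (\bigcup_(k in `I_K)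
         running_moments Fam (z n) nu (k * m).+1 (minn (k.+1 * m) n) w) x &
       (e * Num.sqrt n%:R / 12) `^ nu <= x].
Proof.
move=> nu0 n0 m0 e0 dlm nK w /ereal_sup_gt [_ [[[A f] [B k]] /= +] <-].
move=> [[/= AA Ff] [/= AB Fk] hst]; rewrite lte_fin => he.
have n0' : 0 < n%:R :> R by rewrite ltr0n.
have r0 : 0 < Num.sqrt n%:R :> R by rewrite sqrtr_gt0.
set r := Num.sqrt n%:R in r0 he *.
apply: contrapT => /not_orP [h1 h2].
(* Each half of the oscillation gets [e / 2]. Changing the function over [A] compares two points of
   one path, each within [M1] of the start: [2 * M1 = e * r / 2]. Changing the set costs at most two
   increments of [3 * M2] each: [6 * M2 = e * r / 2]. *)
pose M1 := e * r / 4; pose M2 := e * r / 12.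
have M10 : 0 <= M1 by rewrite /M1 divr_ge0// mulr_ge0// ltW.
have M20 : 0 <= M2 by rewrite /M2 divr_ge0// mulr_ge0// ltW.
have [rho0 _ _ _] := rho_semi Ff Fk Ff.
have [leb_dl rho_dl] : leb ((A `\` B) `|` (B `\` A)) <= dl /\ rho f k <= dl.
  have l0 : 0 <= leb ((A `\` B) `|` (B `\` A)) by exact: fine_ge0.
  by move: hst l0 rho0; rewrite /tau/=; lra.
have fdl : Fdelta Fam rho dl (f \- k) by exists f, k.
case: AA => u [v [u0 uv v1 AE]]; case: AB => u' [v' [u'0 uv' v'1 BE]].
have nle x : x <= 1 -> n%:R * x <= n%:R :> R.
  by move=> x1; rewrite ler_piMr// ltW.
have n_ge0 x : 0 <= x -> 0 <= n%:R * x :> R by move=> x0; rewrite mulr_ge0// ltW.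
have b1 x : 0 <= x -> x <= 1 ->
    `|interp (fun i => z n i (f \- k) w) n (n%:R * x) -
      interp (fun i => z n i (f \- k) w) n 0| <= M1.
  move=> x0 x1; have := @interp_bound _ (fun i => z n i (f \- k) w) n 0 n
    (n%:R * x) M1 M10 (leq0n _) (leqnn _) (n_ge0 _ x0) (nle _ x1).
  apply => j j0 jn.
  by apply: (running_moments_le nu0 M10 h1 fdl); rewrite j0 jn.
have b2 s t : 0 <= s -> s <= t -> t <= 1 -> t - s <= dl ->
    `|interp (fun i => z n i k w) n (n%:R * t) -
      interp (fun i => z n i k w) n (n%:R * s)| <= 3 * M2.
  move=> s0 st t1 tsdl; apply: (@interp_modulus _ _ n m) => //.
  - move=> q j qj jq jn.
    have hq : (q < K)%N.
      rewrite -(ltn_pmul2r m0); apply: leq_trans nK; exact: leq_trans jn.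
    have h3 : ~ (exists2 x, running_moments Fam (z n) nu (q * m).+1
        (minn (q.+1 * m) n) w x & M2 `^ nu <= x).
      by move=> [x qx Mx]; apply: h2; exists x => //; exists q.
    by apply: (running_moments_le nu0 M20 h3 Fk); rewrite qj leq_min jq jn.
  - exact: n_ge0.
  - by rewrite ler_wpM2l// ltW.
  - exact: nle.
  - rewrite -mulrBr; apply: le_trans dlm; rewrite mulrC ler_wpM2r//; exact: ltW.
have d1 : `|Zs P X n (A, f) w - Zs P X n (A, k) w| <= e / 2.
  rewrite Zs_sub// AE ZsE// normrM gtr0_norm ?invr_gt0// mulrC ler_pdivrMr// -/r.
  have v0 : 0 <= v by lra. have u1 : u <= 1 by lra.
  have := b1 v v0 v1; have := b1 u u0 u1.
  rewrite /z /M1 !ler_norml => /andP[? ?] /andP[? ?].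
  by apply/andP; split; lra.
have d2 : `|Zs P X n (A, k) w - Zs P X n (B, k) w| <= e / 2.
  rewrite AE BE !ZsE// -mulrBr normrM gtr0_norm ?invr_gt0// mulrC ler_pdivrMr// -/r.
  rewrite AE BE in leb_dl.
  have b3 s t : 0 <= s -> s <= 1 -> 0 <= t -> t <= 1 -> `|s - t| <= dl ->
    `|interp (fun i => z n i k w) n (n%:R * t) -
      interp (fun i => z n i k w) n (n%:R * s)| <= 3 * M2.
    move=> s0 s1 t0 t1; rewrite ler_norml => /andP[st1 st2].
    have [st|ts] := leP s t; first by apply: b2 => //; lra.
    by rewrite distrC; apply: b2 => //; lra.
  have [[hu hv]|[hu hv]] := leb_symdiff_ge uv uv' leb_dl.
    have := b3 u u' u0 (le_trans uv v1) u'0 (le_trans uv' v'1) hu.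
    have := b3 v v' (le_trans u0 uv) v1 (le_trans u'0 uv') v'1 hv.
    rewrite /z /M2 !ler_norml => /andP[? ?] /andP[? ?].
    by apply/andP; split; lra.
  have := b2 u v u0 uv v1 hu; have := b2 u' v' u'0 uv' v'1 hv.
  rewrite /z /M2 !ler_norml => /andP[? ?] /andP[? ?].
  by apply/andP; split; lra.
move: he; rewrite ltNge => /negP; apply.
move: d1 d2; rewrite !ler_norml => /andP[? ?] /andP[? ?].
by apply/andP; split; lra.
Qed.

Variables (nu : R) (g : nat -> R -> R) (h : nat -> R).
Hypothesis nu2 : 2 < nu.
Hypothesis g_moment : forall n dl i j, 0 < dl -> (1 <= i)%N ->
  (i <= j <= n)%N ->
  (outer_expect P (fun w => ereal_sup
     [set ((`|Ssum P X n i j f w|) `^ nu)%:E | f in Fdelta Fam rho dl])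
   <= ((g (j - i + 1)%N dl) `^ (nu / 2))%:E)%E.
Hypothesis h_moment : forall n i j, (1 <= i)%N -> (i <= j <= n)%N ->
  (outer_expect P (fun w => ereal_sup
     [set ((`|Ssum P X n i j f w|) `^ nu)%:E | f in Fam])
   <= ((h (j - i + 1)%N) `^ (nu / 2))%:E)%E.

Lemma sqrt_powR n : Num.sqrt (n%:R : R) `^ nu = n%:R `^ (nu / 2).
Proof. by rewrite -powR12_sqrt// -powRrM mulrC. Qed.

(** As [Num.sqrt n%:R] to the power [nu] is [n] to the power [nu / 2], the ratio in Markov's
    inequality depends on [x] only through [x / n%:R], the quantity controlled by (3) and (4). *)
Lemma threshold_div n (c x A e : R) : (0 < n)%N -> 0 < c -> 0 < e -> 0 <= x ->
  A * x `^ (nu / 2) / (e * Num.sqrt n%:R / c) `^ nu =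
  A * (c / e) `^ nu * (x / n%:R) `^ (nu / 2).
Proof.
move=> n0 c0 e0 x0; have n0' : 0 < n%:R :> R by rewrite ltr0n.
have -> : e * Num.sqrt n%:R / c = Num.sqrt n%:R / (c / e).
  by field; rewrite !gt_eqF.
have : 0 < c / e by rewrite divr_gt0.
move: (c / e) => q q0.
rewrite !powRM ?invr_ge0 ?sqrtr_ge0 ?(ltW n0') ?(ltW q0)// sqrt_powR.
have inv (y r : R) : 0 < y -> y^-1 `^ r = (y `^ r)^-1.
  by move=> y0; rewrite -powR_inv1 ?ltW// -powRrM mulN1r powRN.
rewrite !inv//; field.
by rewrite !gt_eqF// powR_gt0.
Qed.

Lemma oscillation_prob (Qg Qh : R) :
  (forall dl, 0 < dl -> condS (nu / 2) (g ^~ dl) Qg) ->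
  condS (nu / 2) h Qh ->
  exists Ag Ah : R, [/\ 0 <= Ag, 0 <= Ah &
    forall e dl n m, 0 < e -> 0 < dl -> (0 < n)%N -> (0 < m <= n)%N ->
      dl * n%:R <= m%:R ->
      (outer_prob P (oscillation n dl e) <=
        (Ag * (4 / e) `^ nu * (g n dl / n%:R) `^ (nu / 2) +
         2 / dl * (Ah * (12 / e) `^ nu * (h m / n%:R) `^ (nu / 2)))%:E)%E].
Proof.
move=> Sg Sh; have nu0 : 0 < nu by apply: lt_trans nu2.
(* The radius 1 serves only to read off the range of [Qg]; the index is common to all radii, so [Ag]
   does not depend on [dl]. *)
have [Qg1 Qg2 _ _ _] := Sg 1 ltr01.
have [Qh1 Qh2 h0 hmono _] := Sh.
have [Ag Ag0 HAg] := moricz_inequality P nu2 Qg1 Qg2.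
have [Ah Ah0 HAh] := moricz_inequality P nu2 Qh1 Qh2.
exists Ag, Ah; split => // e dl n m e0 dl0 n0 /andP[m0 mn] dlm.
have n0' : 0 < n%:R :> R by rewrite ltr0n.
have m0' : 0 < m%:R :> R by rewrite ltr0n.
have r0 : 0 < Num.sqrt n%:R :> R by rewrite sqrtr_gt0.
have [_ _ g0 _ _] := Sg dl dl0.
pose K := (n %/ m).+1.
have nK : (n <= K * m)%N by rewrite /K ltnW// ltn_ceil.
(* As [m <= n], the quotient [n %/ m] is at least 1, so [K] is at most twice it; and it is at most
   [1 / dl] because [dl * n%:R <= m%:R]. *)
have K2 : K%:R <= 2 / dl.
  rewrite ler_pdivlMr//; have h1 : ((n %/ m) * m <= n)%N by exact: leq_trunc_div.
  have h2 : (1 <= n %/ m)%N by rewrite divn_gt0.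
  have h3 : ((n %/ m)%:R * m%:R <= n%:R :> R) by rewrite -natrM ler_nat.
  have h4 : (1 <= (n %/ m)%:R :> R) by rewrite ler1n.
  have h5 : (n %/ m)%:R * (dl * n%:R) <= (n %/ m)%:R * m%:R :> R.
    by rewrite ler_wpM2l.
  rewrite -(ler_pM2r n0') /K -natr1.
  apply: (@le_trans _ _ (2 * ((n %/ m)%:R * (dl * n%:R)))); last lra.
  have h6 : 0 <= dl * n%:R by rewrite mulr_ge0// ltW.
  have : dl * n%:R <= (n %/ m)%:R * (dl * n%:R) by rewrite ler_peMl.
  by lra.
have osc := oscillation_sub nu0 n0 m0 e0 dlm nK.
apply: le_trans (outer_prob_subU P osc) _; rewrite EFinD; apply: leeD.
  rewrite -threshold_div//; last exact: g0.
  apply: (majorizable_markov (B := running_moments (Fdelta Fam rho dl) (z n) nu 1 n)).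
  - by rewrite powR_gt0// divr_gt0// mulr_gt0.
  - have := HAg _ (Fdelta Fam rho dl) (z n) (g ^~ dl) n (Sg _ dl0).
    have hyp i j : (1 <= i)%N -> (i <= j <= n)%N -> majorizable P
      (fun w => [set `|psum (z n) i j f w| `^ nu | f in Fdelta Fam rho dl])
      (g (j - i + 1)%N dl `^ (nu / 2)).
      move=> i1 ijn; apply: outer_expect_majorizable.
      + exact: powR_ge0.
      + by move=> f w; exact: powR_ge0.
      + exact: g_moment.
    move=> /(_ hyp 1%N n isT); rewrite n0 leqnn => /(_ isT).
    by rewrite subnK.
  - by [].
rewrite -threshold_div//; last exact: h0.
apply: (@le_trans _ _ (K%:R * (Ah * h m `^ (nu / 2)) /
    (e * Num.sqrt n%:R / 12) `^ nu)%:E); last first.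
  rewrite lee_fin -mulrA ler_wpM2r// mulr_ge0 ?invr_ge0 ?powR_ge0//.
  by rewrite mulr_ge0// powR_ge0.
apply: (majorizable_markov (B := fun w => \bigcup_(k in `I_K)
    running_moments Fam (z n) nu (k * m).+1 (minn (k.+1 * m) n) w)).
- by rewrite powR_gt0// divr_gt0// mulr_gt0.
- apply: majorizable_bigcup => k kK.
  have c0 : 0 <= Ah * h m `^ (nu / 2) by rewrite mulr_ge0// powR_ge0.
  (* When [m] divides [n] the last block starts at [n + 1] and contains no index. *)
  have [nk|kn] := leqP n (k * m).
    apply: (majorizable_le c0 _ (majorizable0 P)) => w x _ [f [j [_ + _]]].
    rewrite leq_min => /andP[kj /andP[_ jn]].
    by move: kj; rewrite ltnNge (leq_trans jn nk).
  have hyp i j : (1 <= i)%N -> (i <= j <= n)%N -> majorizable P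
    (fun w => [set `|psum (z n) i j f w| `^ nu | f in Fam])
    (h (j - i + 1)%N `^ (nu / 2)).
    move=> i1 ijn; apply: outer_expect_majorizable.
    + exact: powR_ge0.
    + by move=> f w; exact: powR_ge0.
    + exact: h_moment.
  have k1 : (1 <= (k * m).+1)%N by [].
  have kmin : ((k * m).+1 <= minn (k.+1 * m) n <= n)%N.
    by rewrite leq_min geq_minr kn mulSn -[X in (X < _)%N]add0n ltn_add2r m0.
  have := HAh _ Fam (z n) h n Sh hyp _ _ k1 kmin.
  set l := (_ - _ + 1)%N => hmaj.
  have l0 : (0 < l)%N by rewrite /l addn1.
  have lm : (l <= m)%N.
    rewrite /l addn1 ltn_subLR; last by case/andP: kmin.
    rewrite addSn ltnS -mulSnr; exact: geq_minl.
  apply: majorizable_le hmaj => //.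
  rewrite ler_wpM2l//; apply: powR_le; [lra|exact: h0|exact: hmono].
- by [].
Qed.

(** Stated with neighbourhoods because it is used twice: the limit in [AEC] follows from it, and
    weak convergence needs a single radius valid for all large [n]. *)
Lemma AEC_near :
  (exists Qg : R, forall dl, 0 < dl -> condS (nu / 2) (g ^~ dl) Qg) ->
  (exists Qh : R, condS (nu / 2) h Qh) ->
  (limn_esup (fun n => (g n dl / n%:R)%:E)) @[dl --> 0^'+] --> 0%E ->
  (exists C : R, 0 <= C /\
     forall eps : R, 0 < eps <= 1 ->
       (limn_esup (fun n =>
          ((let m := Num.truncn (n%:R * eps) in
            if m == 0%N then 0 else h m) / n%:R)%:E)
        <= (C * eps)%:E)%E) ->
  forall e eta : R, 0 < e -> 0 < eta -> \forall dl \near (0:R)^'+,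
    \forall n \near \oo, (outer_prob P (oscillation n dl e) <= eta%:E)%E.
Proof.
move=> [Qg Sg] [Qh Sh] h3 [C [C0 h4]] e eta e0 eta0.
have [Ag [Ah [Ag0 Ah0 HP]]] := oscillation_prob Sg Sh.
have al0 : 0 < nu / 2 by move: nu2; lra.
have al1 : 0 < nu / 2 - 1 by move: nu2; lra.
have eta20 : 0 < eta / 2 by lra.
have [kap kap0 hkap] : exists2 kap : R, 0 < kap &
    Ag * (4 / e) `^ nu * kap `^ (nu / 2) <= eta / 2.
  have nr := near_right_powR_le (Ag * (4 / e) `^ nu) al0 eta20.
  have /filter_ex [kap [? ?]] : \forall x \near (0:R)^'+, 0 < x /\
      Ag * (4 / e) `^ nu * x `^ (nu / 2) <= eta / 2.
    by near=> x; split; [near: x; exact: nbhs_right_gt|near: x].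
  by exists kap.
have C10 : 0 < 2 * C + 1 by lra.
(* The block term is [2 / dl] times a constant times [(2 * C + 1) * dl] to the power [nu / 2]. One
   power of [dl] cancels, and [nu / 2 - 1] is positive. *)
have nr := near_right_powR_le
  (2 * Ah * (12 / e) `^ nu * (2 * C + 1) `^ (nu / 2)) al1 eta20.
have kap0' : (0 < kap%:E :> \bar R)%E by rewrite lte_fin.
have nr3 : \forall dl \near (0:R)^'+,
    (limn_esup (fun n => (g n dl / n%:R)%:E) < kap%:E)%E.
  exact: (h3 _ (open_ereal_lt' kap0')).
near=> dl.
have dl0 : 0 < dl by near: dl; exact: nbhs_right_gt.
have dl2 : dl < 1 / 2 by near: dl; apply: nbhs_right_lt; lra.
have hD : 2 * Ah * (12 / e) `^ nu * (2 * C + 1) `^ (nu / 2) *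
    dl `^ (nu / 2 - 1) <= eta / 2 by near: dl.
have hg : (limn_esup (fun n => (g n dl / n%:R)%:E) < kap%:E)%E.
  by near: dl.
(* Assumption (4) is used at [2 * dl], which is at most 1. The surplus [dl] makes the bound strict,
   hence valid for all large [n]. *)
have {}h4 : (limn_esup (fun n =>
    ((let m := Num.truncn (n%:R * (2 * dl)) in
      if m == 0%N then 0 else h m) / n%:R)%:E) < ((2 * C + 1) * dl)%:E)%E.
  apply: le_lt_trans (h4 (2 * dl) _) _; first by apply/andP; split; lra.
  rewrite lte_fin; have : 0 < dl by []. by lra.
have {}hg := limn_esup_lt hg; have {}h4 := limn_esup_lt h4.
near=> n.
have ndl : 1 / dl < n%:R by near: n; exact: nbhs_infty_gtr.
have n0' : 0 < n%:R :> R by apply: lt_trans ndl; rewrite divr_gt0.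
have n0 : (0 < n)%N by rewrite -(ltr0n R).
have hgn : ((g n dl / n%:R)%:E < kap%:E)%E by near: n.
have h4n : (((let m := Num.truncn (n%:R * (2 * dl)) in
      if m == 0%N then 0 else h m) / n%:R)%:E < ((2 * C + 1) * dl)%:E)%E.
  by near: n.
set m := Num.truncn (n%:R * (2 * dl)).
(* Once [n%:R * dl] exceeds 1, the integer part [m] of its double exceeds it too. So [m] is
   positive, which removes the convention at 0, and blocks of length [m] are long enough. *)
have ndl1 : 1 < n%:R * dl by rewrite -ltr_pdivrMr.
have x0 : 0 <= n%:R * (2 * dl) by lra.
have /andP[m_le m_gt] := truncn_itv x0.
rewrite -/m -natr1 in m_le m_gt.
have m0 : (0 < m)%N by rewrite /m truncn_gt0; lra.
have mn : (m <= n)%N.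
  rewrite -(ler_nat R); apply: le_trans m_le _.
  by rewrite ler_piMr ?ltW//; lra.
have dlm : dl * n%:R <= m%:R by lra.
move: h4n; rewrite /= -/m gtn_eqF// lte_fin => h4n.
rewrite lte_fin in hgn.
have [_ _ g0 _ _] := Sg _ dl0; have [_ _ h0 _ _] := Sh.
apply: le_trans (HP e dl n m e0 dl0 n0 _ dlm) _; first by rewrite m0.
rewrite lee_fin; have -> : eta = eta / 2 + eta / 2 by lra.
apply: lerD.
  apply: (le_trans _ hkap); apply: ler_wpM2l.
    by rewrite mulr_ge0// powR_ge0.
  by apply: powR_le; [lra|rewrite divr_ge0 ?(ltW n0')// g0|exact: ltW].
apply: (le_trans _ hD).
have hb : (h m / n%:R) `^ (nu / 2) <= ((2 * C + 1) * dl) `^ (nu / 2).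
  by apply: powR_le; [lra|rewrite divr_ge0 ?(ltW n0')// h0|exact: ltW].
apply: (@le_trans _ _ (2 / dl * (Ah * (12 / e) `^ nu *
    ((2 * C + 1) * dl) `^ (nu / 2)))).
  apply: ler_wpM2l; first by rewrite divr_ge0// ltW.
  by apply: ler_wpM2l => //; rewrite mulr_ge0// powR_ge0.
rewrite powRM ?(ltW C10) ?(ltW dl0)// -(mulr_powRB1 (ltW dl0) al0).
rewrite le_eqVlt; apply/orP; left; apply/eqP; field.
by rewrite gt_eqF.
Unshelve. all: by end_near.
Qed.

End Equicontinuity.

(** * Expectations under perturbation, and measurability *)

Section Expectation.
Context {R : realType} {d : measure_display} {T : measurableType d}.
Variable P : probability T R.

Lemma measurable_fun_gtP (f : T -> R) :
  (forall a : R, measurable [set w | a < f w]) -> measurable_fun [set: T] f.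
Proof.
move=> h; apply: (measurability _ (RGenOInfty.measurableE R)).
move=> _ [_ [a ->] <-]; rewrite setTI.
have -> : f @^-1` `]a, +oo[ = [set w | a < f w].
  by apply/seteqP; split => w /=; rewrite in_itv/= andbT.
exact: h.
Qed.

Lemma integrable_bounded (f : T -> R) (M : R) :
  measurable_fun [set: T] f -> (forall w, `|f w| <= M) ->
  P.-integrable [set: T] (fun w => (f w)%:E).
Proof.
move=> mf fM; have iM := finite_measure_integrable_cst P M measurableT.
apply: le_integrable iM => //; first exact/measurable_EFinP.
by move=> w _; rewrite !abse_EFin lee_fin (le_trans (fM w))// ler_norm.
Qed.

(** Meant for functions that differ by at most [a] off an unlikely event [A] and by a crude extra
    [b] on it. *)
Lemma integral_le_perturb (f g : T -> R) (A : set T) (M a b c : R) :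
  measurable_fun [set: T] f -> measurable_fun [set: T] g ->
  (forall w, `|f w| <= M) -> (forall w, `|g w| <= M) -> measurable A ->
  0 <= b -> (P A <= c%:E)%E -> (forall w, f w <= g w + (a + b * \1_A w)) ->
  (\int[P]_w (f w)%:E <= \int[P]_w (g w)%:E + (a + b * c)%:E)%E.
Proof.
move=> mf mg fM gM mA b0 PA fg.
have iA : P.-integrable [set: T] (fun w => (b * \1_A w)%:E).
  rewrite (_ : (fun w => _) = (fun w => b%:E * (\1_A w)%:E)%E).
    by apply: integrableZl => //; exact: integrable_indic.
  by apply/funext => w; rewrite EFinM.
have ia : P.-integrable [set: T] (fun w => (a + b * \1_A w)%:E).
  apply: (eq_integrable measurableT (fun w => (EFin \o cst a) w + (b * \1_A w)%:E)%E).
    by move=> w _; rewrite /= EFinD.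
  by apply: integrableD => //; exact: finite_measure_integrable_cst.
apply: (@le_trans _ _ (\int[P]_w ((g w)%:E + (a + b * \1_A w)%:E))%E).
  apply: le_integral => //.
  - exact: integrable_bounded fM.
  - by apply: integrableD => //; exact: integrable_bounded gM.
  - by move=> w _; rewrite -EFinD lee_fin.
rewrite integralD//; last exact: integrable_bounded gM.
apply: leeD => //.
rewrite (eq_integral (fun w => (EFin \o cst a) w + (b * \1_A w)%:E)%E); last first.
  by move=> w _; rewrite /= EFinD.
rewrite (integralD measurableT (finite_measure_integrable_cst P a measurableT) iA).
under [X in (_ + X)%E]eq_integral do rewrite EFinM.
rewrite (integralZl measurableT (integrable_indic P mA)).
rewrite integral_indic// setIT.
have -> : (\int[P]_x (EFin \o cst a) x = a%:E)%E.
  have := integral_cst P measurableT a%:E.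
  by rewrite [X in (_ * X)%E]probability_setT mule1.
by rewrite EFinD EFinM leeD// lee_wpmul2l.
Qed.

Lemma outer_expect_le (Y1 Y2 : T -> \bar R) : (forall w, (Y1 w <= Y2 w)%E) ->
  (outer_expect P Y1 <= outer_expect P Y2)%E.
Proof.
move=> h; apply: ereal_inf_le_tmp => _ [U [mU YU fU] <-]; exists U => //.
by split => // w; apply: le_trans (h w) _.
Qed.

Lemma outer_expect_le_integral (Y : T -> \bar R) (U : T -> R) (M : R) :
  measurable_fun [set: T] U -> (forall w, `|U w| <= M) ->
  (forall w, (Y w <= (U w)%:E)%E) ->
  (outer_expect P Y <= \int[P]_w (U w)%:E)%E.
Proof.
move=> mU UM YU; have iU := integrable_bounded mU UM.
apply: ereal_inf_lbound; exists (fun w => (U w)%:E) => //; split => //.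
  exact/measurable_EFinP.
by left; apply: integral_funepos_lt_pinfty.
Qed.

(** A competitor [U] may have an infinite integral, so the comparison is made on positive and
    negative parts separately. *)
Lemma integral_le_outer_expect (Y : T -> \bar R) (W : T -> R) (M : R) :
  measurable_fun [set: T] W -> (forall w, `|W w| <= M) ->
  (forall w, ((W w)%:E <= Y w)%E) ->
  (\int[P]_w (W w)%:E <= outer_expect P Y)%E.
Proof.
move=> mW WM WY; have iW := integrable_bounded mW WM.
have mW' : measurable_fun [set: T] (fun w => (W w)%:E) by exact/measurable_EFinP.
apply: le_ereal_inf_tmp => _ [U [mU YU _] <-].
have WU w : ((W w)%:E <= U w)%E by apply: le_trans (WY w) (YU w).
rewrite [leLHS]integralE [leRHS]integralE; apply: leeB.
  apply: ge0_le_integral => //; try exact: measurable_funepos.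
  by move=> w _; apply: (funepos_le (D := setT)) (in_setT w) => x _.
apply: ge0_le_integral => //; try exact: measurable_funeneg.
by move=> w _; apply: (funeneg_le (D := setT)) (in_setT w) => x _.
Qed.

(** The set where [phi] exceeds [a] is open, hence a union of cubes with rational centres and radii
    of the form 1/(N+1). These are countably many, and the preimage of each is a finite intersection
    of measurable sets. *)
Lemma measurable_fun_row (k : nat) (Y : 'I_k -> T -> R) (phi : 'rV[R]_k -> R) :
  (forall i, measurable_fun [set: T] (Y i)) -> continuous phi ->
  measurable_fun [set: T] (fun w => phi (\row_i Y i w)).
Proof.
move=> mY cphi; apply: measurable_fun_gtP => a.
pose box (qr : {ffun 'I_k -> rat} * nat) : set 'rV[R]_k :=
  [set v | forall i, `|v 0 i - ratr (qr.1 i)| < qr.2.+1%:R^-1].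
pose good := [set qr | forall v, box qr v -> a < phi v].
have -> : [set w | a < phi (\row_i Y i w)] = \bigcup_(qr in good)
    [set w | box qr (\row_i Y i w)].
  apply/seteqP; split => [w /= aw|w [qr gqr] /= bw]; last exact: gqr.
  have [e e0 he] : exists2 e : R, 0 < e & forall v : 'rV[R]_k,
      (forall i, `|v 0 i - Y i w| < e) -> a < phi v.
    have : nbhs (\row_i Y i w : 'rV[R]_k) [set v | a < phi v].
      exact: (cvgr_gt _ (cphi (\row_i Y i w)) _ aw).
    move=> /nbhs_ballP [e /= e0 he]; exists e => // v hv.
    apply: he; split => // i j; rewrite ord1 /ball/= mxE distrC; exact: hv.
  (* Points of the cube around a centre within 1/(N+1) of the row are within twice that radius of
     the row, hence [e / 2]. *)
  have [N hN] : exists N : nat, N.+1%:R^-1 < e / 2.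
    have [N _ hN] := near_infty_natSinv_lt (PosNum (divr_gt0 e0 (ltr0Sn R 1))).
    by exists N; exact: (hN N (leqnn N)).
  have N0 : 0 < N.+1%:R^-1 :> R by rewrite invr_gt0.
  have hq i : exists q : rat, `|Y i w - ratr q| < N.+1%:R^-1.
    have : Y i w - N.+1%:R^-1 < Y i w by rewrite ltrBlDr ltrDl.
    move=> /rat_in_itvoo [q]; rewrite in_itv/= => /andP[q1 q2]; exists q.
    rewrite ltr_norml; apply/andP; split; last by rewrite ltrBlDr -ltrBlDl.
    by apply: (@lt_trans _ _ 0); rewrite ?oppr_lt0 ?subr_gt0.
  pose q : {ffun 'I_k -> rat} := [ffun i => projT1 (cid (hq i))].
  have qE i : `|Y i w - ratr (q i)| < N.+1%:R^-1.
    by rewrite /q ffunE; case: (cid (hq i)).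
  exists (q, N); last by move=> i /=; rewrite mxE.
  move=> v hv; apply: he => i.
  have := hv i; have := qE i; move: hN; rewrite /=; move: (N.+1%:R^-1) => c ?.
  rewrite !ltr_norml => /andP[? ?] /andP[? ?].
  by apply/andP; split; lra.
rewrite bigcup_mkcond; apply: countable_bigcupT_measurable => // qr.
case: ifPn => // _; rewrite (_ : [set w | _] = \bigcap_(i in [set: 'I_k])
    [set w | `|Y i w - ratr (qr.1 i)| < qr.2.+1%:R^-1]); last first.
  apply/seteqP; split => w /=; first by move=> h i _; have := h i; rewrite mxE.
  by move=> h i; rewrite mxE; exact: h.
apply: fin_bigcap_measurable => // i _.
rewrite -[X in measurable X]setTI.
have mf : measurable_fun [set: T] (fun w => `|Y i w - ratr (qr.1 i)|).
  by apply: measurableT_comp => //; apply: measurable_funB.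
have := mf measurableT [set` `]-oo, (qr.2.+1%:R^-1 : R)[] (measurable_itv _).
by congr (measurable (_ `&` _)); apply/seteqP; split => w /=; rewrite in_itv.
Qed.

End Expectation.

(** * Topology of bounded functions, inf-convolution and tightness *)

Section FunctionSpace.
Context {R : realType} {I : Type}.
Implicit Types (x y : I -> R) (hh L : (I -> R) -> R).

Lemma supdist_lt x y (r : R) : (supdist x y < r%:E)%E ->
  forall t, `|x t - y t| < r.
Proof.
move=> h t; rewrite -lte_fin; apply: le_lt_trans h.
by apply: ereal_sup_ubound; exists t.
Qed.

Lemma supdist_ltW x y (c r : R) : c < r -> (forall t, `|x t - y t| <= c) ->
  (supdist x y < r%:E)%E.
Proof.
move=> cr h; apply: (@le_lt_trans _ _ c%:E); last by rewrite lte_fin.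
by apply: ge_ereal_sup => _ [t _ <-]; rewrite lee_fin.
Qed.

(** A real bound [c] on all coordinates replaces [supdist], which is extended real and equals [-oo]
    for empty [I]. *)
Definition lipschitz_linf L (K : R) : Prop := 0 <= K /\
  forall x y (c : R), linf x -> linf y -> 0 <= c ->
    (forall t, `|x t - y t| <= c) -> `|L x - L y| <= K * c.

Lemma lipschitz_linf_continuous L K : lipschitz_linf L K -> linf_continuous L.
Proof.
move=> [K0 hL] x Ix e e0.
have K1 : 0 < K + 1 by rewrite ltr_wpDl.
have r0 : 0 < e / (K + 1) by rewrite divr_gt0.
exists (e / (K + 1)) => // y Iy /supdist_lt h.
apply: (@le_lt_trans _ _ (K * (e / (K + 1)))).
  by apply: hL => //; [exact: ltW|move=> t; exact: ltW].
by rewrite mulrCA gtr_pMr// ltr_pdivrMr// mul1r ltrDl.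
Qed.

Lemma lipschitz_linf_eval (t : I) : lipschitz_linf (fun x => x t) 1.
Proof. by split => // x y c _ _ _ h; rewrite mul1r. Qed.

Lemma linf_continuous_open hh (a : R) : linf_continuous hh ->
  linf_open [set x | linf x /\ a < hh x].
Proof.
move=> ch; split => [x []//|x [Ix ax]].
have e0 : 0 < hh x - a by rewrite subr_gt0.
have [r r0 hr] := ch x Ix _ e0; exists r => // y Iy xy; split => //.
by have := hr y Iy xy; rewrite ltr_norml => /andP[_ ?]; lra.
Qed.

Lemma linf0 : linf ((fun=> 0) : I -> R).
Proof. by exists 0 => t; rewrite normr0. Qed.

Lemma finite_set_ind (A : Type) (Q : set A -> Prop) :
  Q set0 -> (forall a D, Q D -> Q (a |` D)) ->
  forall D, finite_set D -> Q D.
Proof.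
move=> Q0 QU D /(@finite_seqP {classic A}) [s ->]; elim: s => [|a s IH].
  by rewrite (_ : [set` _] = set0)//; apply/seteqP; split.
rewrite (_ : [set` _] = a |` [set` s]); first exact: QU.
apply/seteqP; split => b /=; rewrite inE; first by move=> /orP[/eqP|]; [left|right].
by move=> [->|->]; rewrite ?eqxx ?orbT.
Qed.

(** The sets [far r] are open and cover [K], since each of its members differs from [x] at some
    coordinate. A finite subcover has a smallest [r], and the ball of that radius around [x] misses
    [K]. This makes the event in [tight_linf] measurable. *)
Lemma linf_compact_closed (K : set (I -> R)) : linf_compact K ->
  linf_open (@linf R I `\` K).
Proof.
move=> [Kl Kc]; split => [x []//|x [Ix nKx]].
pose far (r : R) := [set y : I -> R | linf y /\ exists t, r < `|x t - y t|].
pose C : set (set (I -> R)) := [set far r | r in [set r | 0 < r]].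
have Copen : C `<=` @linf_open R I.
  move=> _ [r /= r0 <-]; split => [y []//|y [Iy [t rt]]].
  exists (`|x t - y t| - r); first by rewrite subr_gt0.
  move=> z Iz /supdist_lt /(_ t) h; split => //; exists t.
  have := ler_normD (x t - z t) (z t - y t); rewrite subrKA.
  by move: h; rewrite distrC => h; lra.
have Kcov : K `<=` \bigcup_(O in C) O.
  move=> y Ky; have [t xyt] : exists t, x t != y t.
    apply: contrapT => /forallNP h; apply: nKx; rewrite (_ : x = y)//.
    by apply/funext => t; have := h t => /negP; rewrite negbK => /eqP.
  have n0 : 0 < `|x t - y t| by rewrite normr_gt0 subr_eq0.
  exists (far (`|x t - y t| / 2)); first by exists (`|x t - y t| / 2) => //=; lra.
  by split; [exact: Kl|exists t; lra].
have [D finD [DC KD]] := Kc C Copen Kcov.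
have [r r0 hr] : exists2 r : R, 0 < r & \bigcup_(O in D) O `<=` far r.
  apply: (finite_set_ind (Q := fun D => D `<=` C ->
    exists2 r : R, 0 < r & \bigcup_(O in D) O `<=` far r) _ _ finD DC).
    by move=> _; exists 1 => // y [].
  move=> O {KD finD DC}D IH ODC.
  have [|r r0 hr] := IH; first by move=> V DV; apply: ODC; right.
  have [r' r'0 OE] := ODC O (or_introl erefl).
  exists (Num.min r r'); first by rewrite lt_min r0.
  move=> y [V [->|DV] Vy].
    move: Vy; rewrite -OE => -[Iy [t rt]]; split => //; exists t.
    by rewrite gt_min rt orbT.
  have [|Iy [t rt]] := hr y; first by exists V.
  by split => //; exists t; rewrite gt_min rt.
exists r => // y Iy /supdist_lt h; split => // Ky.
have [_ [t rt]] := hr y (KD y Ky).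
by have := h t; rewrite ltNge (ltW rt).
Qed.

(** Inf-convolution of [hh] with [m] times the sup norm; [c] runs over the upper bounds of the
    distance from [x] to [y]. *)
Definition lower_reg hh (m : R) x : R :=
  inf [set r | exists y (c : R), [/\ linf y, 0 <= c,
    forall t, `|x t - y t| <= c & r = hh y + m * c]].

Section Regularization.
Variables (hh : (I -> R) -> R) (M m : R).
Hypothesis hhM : forall x, linf x -> `|hh x| <= M.
Hypothesis m0 : 0 <= m.

Let vals x := [set r | exists y (c : R), [/\ linf y, 0 <= c,
    forall t, `|x t - y t| <= c & r = hh y + m * c]].

Let vals_lb x : lbound (vals x) (- M).
Proof.
move=> _ [y [c [Iy c0 _ ->]]]; have := hhM Iy; rewrite ler_norml => /andP[h _].
by apply: (le_trans h); rewrite lerDl mulr_ge0.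
Qed.

Let vals_self x : linf x -> vals x (hh x).
Proof.
move=> Ix; exists x, 0; split => //; last by rewrite mulr0 addr0.
by move=> t; rewrite subrr normr0.
Qed.

Lemma lower_reg_ge x : linf x -> - M <= lower_reg hh m x.
Proof.
by move=> Ix; apply: lb_le_inf; [exists (hh x); exact: vals_self|exact: vals_lb].
Qed.

Lemma lower_reg_le x : linf x -> lower_reg hh m x <= hh x.
Proof.
by move=> Ix; apply: ge_inf; [exists (- M); exact: vals_lb|exact: vals_self].
Qed.

Lemma lower_reg_bounded x : linf x -> `|lower_reg hh m x| <= M.
Proof.
move=> Ix; rewrite ler_norml lower_reg_ge//=.
by apply: le_trans (lower_reg_le Ix) _; apply: le_trans (hhM Ix); exact: ler_norm.
Qed.

(** A candidate [(z, c')] for [y] becomes the candidate [(z, c + c')] for [x], at the extra cost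
    [m * c]. *)
Lemma lower_reg_lipschitz : lipschitz_linf (lower_reg hh m) m.
Proof.
split => //; suff H x y (c : R) : linf x -> linf y -> 0 <= c ->
    (forall t, `|x t - y t| <= c) -> lower_reg hh m x <= lower_reg hh m y + m * c.
  move=> x y c Ix Iy c0 xyc; rewrite ler_norml; apply/andP; split.
    have yxc t : `|y t - x t| <= c by rewrite distrC.
    by have := H y x c Iy Ix c0 yxc; lra.
  by have := H x y c Ix Iy c0 xyc; lra.
move=> Ix Iy c0 xyc; rewrite -lerBlDr; apply: lb_le_inf.
  by exists (hh y); exact: vals_self.
move=> _ [z [c' [Iz c'0 yz ->]]]; rewrite lerBlDr; apply: ge_inf.
  by exists (- M); exact: vals_lb.
exists z, (c + c'); split => //; [exact: addr_ge0| |ring].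
by move=> t; rewrite -(subrKA (y t)) (le_trans (ler_normD _ _))// lerD.
Qed.

End Regularization.

(** Candidates within [r] of [x] cannot fall below [hh x - e] by continuity. Those farther away pay
    a penalty of at least [n%:R * r], which exceeds the whole range [2 * M] of [hh]. *)
Lemma lower_reg_cvg hh (M : R) x : (forall x, linf x -> `|hh x| <= M) ->
  linf_continuous hh -> linf x ->
  (fun n => lower_reg hh n%:R x) @ \oo --> hh x.
Proof.
move=> hhM ch Ix; apply/cvgrPdist_le => e e0.
have [r r0 hr] := ch x Ix e e0.
near=> n.
have nM : 2 * M / r < n%:R by near: n; exact: nbhs_infty_gtr.
have low := @lower_reg_le hh M n%:R hhM (ler0n _ _) x Ix.
rewrite ger0_norm ?subr_ge0// lerBlDr -lerBlDl; apply: lb_le_inf.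
  by exists (hh x), x, 0; split => //; [move=> t; rewrite subrr normr0|ring].
move=> _ [y [c [Iy c0 xy ->]]].
have [cr|rc] := ltP c r.
  have := hr y Iy (supdist_ltW cr xy); rewrite ltr_norml => /andP[_ h].
  have : 0 <= n%:R * c by rewrite mulr_ge0.
  by lra.
have := hhM x Ix; have := hhM y Iy; rewrite !ler_norml => /andP[? ?] /andP[? ?].
have : 2 * M <= n%:R * c.
  apply: (@le_trans _ _ (n%:R * r)); last by rewrite ler_wpM2l.
  by rewrite -ler_pdivrMr// ltW.
by lra.
Unshelve. all: by end_near.
Qed.

Context {d : measure_display} {T : measurableType d}.
Variable Z : T -> I -> R.
Hypothesis bZ : borel_linf Z.

Lemma borel_linf_open O : linf_open O -> measurable (Z @^-1` O).
Proof. by move=> oO; apply: bZ.2; exact: sub_sigma_algebra. Qed.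

Lemma borel_linf_compact K : linf_compact K -> measurable (Z @^-1` K).
Proof.
move=> cK; apply: bZ.2.
have -> : K = @linf R I `\` (@linf R I `\` K).
  by rewrite setDD setIC setIidl//; exact: cK.1.
by apply: sigma_algebraCD; apply: sub_sigma_algebra; exact: linf_compact_closed.
Qed.

Lemma borel_linf_measurable hh : linf_continuous hh ->
  measurable_fun [set: T] (fun w => hh (Z w)).
Proof.
move=> ch; apply: measurable_fun_gtP => a.
have := borel_linf_open (linf_continuous_open a ch); congr measurable.
by apply/seteqP; split => w /=; [case|split => //; exact: bZ.1].
Qed.

(* By compactness of an almost full set of paths, the oscillation along [sg] of
   all paths of [Z] is controlled, up to a small event, by finitely many
   indices. *)
Lemma tight_oscillation (P : probability T R) (sg : I -> I) (e eta : R) :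
  tight_linf P Z -> 0 < e -> 0 < eta ->
  exists r (t : 'I_r -> I) (B : set T),
    [/\ measurable B, (P B <= eta%:E)%E & forall w, ~ B w ->
      (forall u, `|Z w u - Z w (sg u)| <= 3 * e) \/
      exists j, 2 * e < `|Z w (t j) - Z w (sg (t j))|].
Proof.
move=> tZ e0 eta0; have [K [cK PK]] := tZ eta eta0.
(* The strict margin [a < 3 * e], uniform in [u], makes [U0] open. A path outside every [O t]
   oscillates by at most [2 * e] and so lies in [U0]. *)
pose U0 := [set x : I -> R | linf x /\
  exists2 a, a < 3 * e & forall u, `|x u - x (sg u)| <= a].
pose O (t : I) := [set x : I -> R | linf x /\ 2 * e < `|x t - x (sg t)|].
have oU0 : linf_open U0.
  split => [x []//|x [Ix [a a3 xa]]].
  exists ((3 * e - a) / 4); first lra.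
  move=> y Iy /supdist_lt xy; split => //; exists ((3 * e + a) / 2); first lra.
  move=> u; have := xa u; have := xy u; have := xy (sg u).
  rewrite !ltr_norml !ler_norml => /andP[? ?] /andP[? ?] /andP[? ?].
  by apply/andP; split; lra.
have oO t : linf_open (O t).
  suff : lipschitz_linf (fun x : I -> R => `|x t - x (sg t)|) 2.
    by move=> /lipschitz_linf_continuous /linf_continuous_open; apply.
  split => // x y c _ _ _ xy; apply: le_trans (ler_dist_dist _ _) _.
  have := xy t; have := xy (sg t); rewrite !ler_norml => /andP[? ?] /andP[? ?].
  by apply/andP; split; lra.
pose C := U0 |` range O.
have Copen : C `<=` @linf_open R I by move=> _ [->//|[t _ <-]].
have Kcov : K `<=` \bigcup_(A in C) A.
  move=> x Kx; have Ix := cK.1 x Kx.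
  have [[t ht]|h] := pselect (exists t, 2 * e < `|x t - x (sg t)|).
    by exists (O t); [right; exists t|].
  exists U0; first by left.
  split => //; exists (2 * e); first lra.
  by move=> u; rewrite leNgt; apply/negP => hu; apply: h; exists u.
have [D finD [DC KD]] := cK.2 C Copen Kcov.
have [r [t ht]] : exists r (t : 'I_r -> I),
    \bigcup_(A in D) A `<=` U0 `|` \bigcup_(j in [set: 'I_r]) O (t j).
  apply: (finite_set_ind (Q := fun D => D `<=` C -> exists r (t : 'I_r -> I),
    \bigcup_(A in D) A `<=` U0 `|` \bigcup_(j in [set: 'I_r]) O (t j))
    _ _ finD DC).
    move=> _; exists 0%N, (fun j : 'I_0 => False_rect I (notF (ltn_ord j))).
    by move=> x [].
  move=> A {KD finD DC}D IH ADC.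
  have [|r [t ht]] := IH; first by move=> A' DA'; apply: ADC; right.
  have [AU|[t0 _ AE]] := ADC A (or_introl erefl).
    exists r, t => x [A' [->|DA'] A'x]; first by left; rewrite -AU.
    by apply: ht; exists A'.
  exists r.+1, (fun j => if unlift ord0 j is Some j' then t j' else t0).
  move=> x [A' [->|DA'] A'x].
    by right; exists ord0 => //; rewrite unlift_none AE.
  have [|U0x|[j _ jx]] := ht x; [by exists A'|by left|].
  by right; exists (lift ord0 j) => //; rewrite liftK.
pose G := U0 `|` \bigcup_(j in [set: 'I_r]) O (t j).
have mG : measurable (Z @^-1` G).
  rewrite preimage_setU preimage_bigcup; apply: measurableU.
    exact: borel_linf_open.
  by apply: fin_bigcup_measurable => // j _; exact: borel_linf_open.
exists r, t, (~` (Z @^-1` G)); split.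
- exact: measurableC.
- rewrite probability_setC// leeBlDr; last exact: fin_num_measure.
  apply: (@le_trans _ _ (eta%:E + (1 - eta)%:E)%E).
    by rewrite -EFinD lee_fin; lra.
  rewrite leeD2l//; apply: le_trans PK _.
  apply: le_measure; rewrite ?inE//; first exact: borel_linf_compact.
  by move=> w /= Kw; apply: ht; apply: KD.
- move=> w /contrapT [[_ [a a3 ha]]|[j _ [_ hj]]]; [left|by right; exists j].
  by move=> u; apply: (le_trans (ha u)); exact: ltW.
Qed.

End FunctionSpace.

(** * From equicontinuity and marginals to weak convergence *)

Section WeakConvergence.
Context {R : realType} {I : Type} {d d' : measure_display}
  {T : measurableType d} {T' : measurableType d'}.
Variables (P : probability T R) (P' : probability T' R).
Variables (Zn : nat -> T -> I -> R) (Z : T' -> I -> R).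
Hypothesis Zn_linf : forall n w, linf (Zn n w).
Hypothesis Zn_meas : forall n t, measurable_fun [set: T] (fun w => Zn n w t).
Hypothesis bZ : borel_linf Z.
Hypothesis tZ : tight_linf P' Z.
Hypothesis fidi : fidi_conv P P' Zn Z.

Lemma lipschitz_row_continuous (k : nat) (phi : 'rV[R]_k -> R) (C : R) :
  (forall (u v : 'rV[R]_k) (c : R), 0 <= c ->
    (forall i, `|u 0 i - v 0 i| <= c) ->
    `|phi u - phi v| <= C * c) -> continuous phi.
Proof.
move=> hphi u A /nbhs_ballP [e /= e0 eA].
have C1 : 0 < `|C| + 1 by rewrite ltr_wpDl.
have r0 : 0 < e / (2 * (`|C| + 1)) by rewrite divr_gt0// mulr_gt0.
apply/nbhs_ballP; exists (e / (2 * (`|C| + 1))) => //= v uv; apply: eA.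
rewrite /ball/=; apply: (@le_lt_trans _ _ (C * (e / (2 * (`|C| + 1))))).
  apply: hphi => [|i]; first exact: ltW.
  by have := uv.2 0 i; rewrite /ball/= => /ltW.
apply: (@le_lt_trans _ _ ((`|C| + 1) * (e / (2 * (`|C| + 1))))).
  by rewrite ler_pM2r//; have := ler_norm C; lra.
by rewrite invfM mulrC -mulrA divfK ?gt_eqF// ltr_pdivrMr//; lra.
Qed.

Lemma clamp_lipschitz (x y : R) : `|clamp x - clamp y| <= `|x - y|.
Proof.
have h1 := ler_norm (x - y).
have h2 : y - x <= `|x - y| by rewrite distrC ler_norm.
rewrite ler_norml.
by case: (clampE x) => -[? ->]; case: (clampE y) => -[? ->];
  apply/andP; split; lra.
Qed.

Lemma measurable_gt_bigcup (r : nat)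
  (f : 'I_r -> T' -> R) (a : R) :
  (forall j, measurable_fun [set: T'] (f j)) ->
  measurable [set w | exists j, a < f j w].
Proof.
move=> mf; rewrite (_ : [set w | _] =
  \bigcup_(j in [set: 'I_r]) (f j @^-1` [set` `]a, +oo[])); last first.
  apply/seteqP; split => w /= [j]; first by exists j => //=; rewrite in_itv/= andbT.
  by rewrite /= in_itv/= andbT; exists j.
apply: fin_bigcup_measurable => // j _; rewrite -[X in measurable X]setTI.
exact: mf.
Qed.

(** Marginals are tested by continuous functions only, so the indicator is replaced by a cut-off
    that is 1 above level [2 * e] and vanishes up to level [e]. It dominates the event for [Z] and
    is supported in the event controlled for [Zn]. *)
Lemma fidi_oscillation (sg : I -> I) (e eta : R) (r : nat) (t : 'I_r -> I) :
  0 < e -> 0 < eta ->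
  (\forall n \near \oo,
    (outer_prob P [set w | exists u, (e < `|Zn n w u - Zn n w (sg u)|)%R]
      <= eta%:E)%E) ->
  measurable [set w | exists j, 2 * e < `|Z w (t j) - Z w (sg (t j))|] /\
  (P' [set w | exists j, (2 * e < `|Z w (t j) - Z w (sg (t j))|)%R]
    <= (2 * eta)%:E)%E.
Proof.
move=> e0 eta0 hn.
have mZ u : measurable_fun [set: T'] (fun w => Z w u).
  apply: (borel_linf_measurable bZ (hh := fun x => x u)).
  exact: lipschitz_linf_continuous (lipschitz_linf_eval u).
set A := [set w | _].
have mA : measurable A.
  apply: measurable_gt_bigcup => j; apply: measurableT_comp => //.
  exact: measurable_funB.
split => //.
(* The marginal lists the indices [t j] first and their images under [sg] next, so [mx] reads an
   oscillation off one row. *)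
pose ix (i : 'I_(r + r)) : I :=
  match fintype.split i with inl j => t j | inr j => sg (t j) end.
pose mx (v : 'rV[R]_(r + r)) : R :=
  \big[Num.max/0]_(j < r) `|v 0 (lshift r j) - v 0 (rshift r j)|.
pose phi v := clamp ((mx v - e) / e).
have mx_lip (u v : 'rV[R]_(r + r)) (c : R) : 0 <= c ->
    (forall i, `|u 0 i - v 0 i| <= c) ->
    mx u <= mx v + 2 * c.
  move=> c0 uv; apply: bigmax_le.
    by apply: addr_ge0; [exact: bigmax_ge_id|exact: mulr_ge0].
  move=> j _; apply: (@le_trans _ _
    (`|v 0 (lshift r j) - v 0 (rshift r j)| + 2 * c)); last first.
    rewrite lerD2r.
    exact: (le_bigmax _ (fun j => `|v 0 (lshift r j) - v 0 (rshift r j)|)).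
  have := uv (lshift r j); have := uv (rshift r j).
  have := ler_norm (v 0 (lshift r j) - v 0 (rshift r j)).
  have := ler_norm (- (v 0 (lshift r j) - v 0 (rshift r j))); rewrite normrN.
  rewrite !ler_norml => ? ? /andP[? ?] /andP[? ?].
  by apply/andP; split; lra.
have cphi : continuous phi.
  apply: (lipschitz_row_continuous (C := 2 / e)) => u v c c0 uv.
  apply: le_trans (clamp_lipschitz _ _) _.
  rewrite -mulrBl normrM [`|e^-1|]gtr0_norm ?invr_gt0// mulrAC.
  rewrite ler_pM2r ?invr_gt0// ler_norml.
  have vu i : `|v 0 i - u 0 i| <= c by rewrite distrC.
  have := mx_lip u v c c0 uv; have := mx_lip v u c c0 vu => ? ?.
  by apply/andP; split; lra.
have phi01 v : 0 <= phi v <= 1.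
  by rewrite /phi; case: (clampE ((mx v - e) / e)) => -[? ->]; lra.
have phiM v : `|phi v| <= 1.
  by have /andP[? ?] := phi01 v; rewrite ger0_norm.
have phi_gt (v : 'rV[R]_(r + r)) j :
    2 * e < `|v 0 (lshift r j) - v 0 (rshift r j)| -> phi v = 1.
  move=> hj; apply: clamp_ge1; rewrite ler_pdivlMr// mul1r.
  have := le_bigmax 0 (fun j => `|v 0 (lshift r j) - v 0 (rshift r j)|) j.
  by rewrite -/(mx v); lra.
have phi_pos (v : 'rV[R]_(r + r)) : 0 < phi v ->
    exists j, e < `|v 0 (lshift r j) - v 0 (rshift r j)|.
  move=> phi0; apply: contrapT => /forallNP hj.
  suff : phi v = 0 by move=> E; rewrite E ltxx in phi0.
  apply: clamp_le0; rewrite ler_pdivrMr// mul0r subr_le0.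
  apply: bigmax_le => [|j _]; first exact: ltW.
  by rewrite leNgt; apply/negP; exact: hj.
have ixl j : ix (lshift r j) = t j by rewrite /ix (unsplitK (inl j)).
have ixr j : ix (rshift r j) = sg (t j) by rewrite /ix (unsplitK (inr j)).
have mphiZ : measurable_fun [set: T'] (fun w => phi (\row_i Z w (ix i))).
  by apply: measurable_fun_row.
have PA : (P' A <= \int[P']_w (phi (\row_i Z w (ix i)))%:E)%E.
  have -> : P' A = (\int[P']_w (\1_A w)%:E)%E by rewrite integral_indic// setIT.
  apply: ge0_le_integral => //.
  - by apply/measurable_EFinP; exact: measurable_indic.
  - exact/measurable_EFinP.
  - move=> w _; rewrite lee_fin indicE.
    case: (boolP (w \in A)) => [|_]; last by have /andP[] := phi01 (\row_i Z w (ix i)).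
    rewrite inE => -[j hj]; rewrite (phi_gt _ j)//.
    by rewrite !mxE ixl ixr.
apply: le_trans PA _.
apply: (cvge_to_le (@fidi _ ix _ cphi (ex_intro _ 1 phiM))).
apply: filterS hn => n hn.
(* The infimum need not be attained; the room up to [2 * eta] yields a measurable cover [B]. *)
have : (outer_prob P [set w | exists u, (e < `|Zn n w u - Zn n w (sg u)|)%R]
    < (2 * eta)%:E)%E by apply: le_lt_trans hn _; rewrite lte_fin; lra.
move=> /ereal_inf_lt [_ [B [mB subB] <-] PB].
apply: le_trans (ltW PB).
have -> : P B = (\int[P]_w (\1_B w)%:E)%E by rewrite integral_indic// setIT.
apply: ge0_le_integral => //.
- by move=> w _; rewrite lee_fin; have /andP[] := phi01 (\row_i Zn n w (ix i)).
- by apply/measurable_EFinP; apply: measurable_fun_row.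
- by apply/measurable_EFinP; exact: measurable_indic.
- move=> w _; rewrite lee_fin indicE.
  have /andP[h0 h1] := phi01 (\row_i Zn n w (ix i)).
  have [phi0|] := ltP 0 (phi (\row_i Zn n w (ix i))); last first.
    by move=> h; apply: le_trans h _.
  have [j hj] := phi_pos _ phi0.
  rewrite mem_set//; apply: subB; exists (t j).
  by move: hj; rewrite !mxE ixl ixr.
Qed.

(** Equicontinuity in net form: [s] lists finitely many indices and [p] assigns one of them to every
    index, the same for all large [n]. *)
Hypothesis equicont : forall e eta : R, 0 < e -> 0 < eta ->
  exists (k : nat) (s : 'I_k -> I) (p : I -> 'I_k), \forall n \near \oo,
    (outer_prob P [set w | exists u, (e < `|Zn n w u - Zn n w (s (p u))|)%R]
      <= eta%:E)%E.

Lemma lipschitz_weak_conv (L : (I -> R) -> R) (K M kap : R) :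
  lipschitz_linf L K -> (forall x, linf x -> `|L x| <= M) -> 0 < kap ->
  \forall n \near \oo,
    (outer_expect P (fun w => (L (Zn n w))%:E) <=
       \int[P']_w (L (Z w))%:E + kap%:E)%E /\
    (\int[P']_w (L (Z w))%:E - kap%:E <=
       outer_expect P (fun w => (L (Zn n w))%:E))%E.
Proof.
move=> lipL LM kap0; have [K0 hL] := lipL.
have M0 : 0 <= M by apply: le_trans (normr_ge0 _) (LM _ linf0).
have K10 : 0 < K + 1 by rewrite ltr_wpDl.
have M10 : 0 < M + 1 by rewrite ltr_wpDl.
(* Replacing [Z] by its discretization costs [3 * K * e + 6 * M * eta], replacing [Zn] costs
   [K * e + 4 * M * eta], and the marginals cost [kap / 4]. The total is at most three quarters of
   [kap]. *)
pose e := kap / (16 * (K + 1)); pose eta := kap / (40 * (M + 1)).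
have e0 : 0 < e by rewrite divr_gt0// mulr_gt0.
have eta0 : 0 < eta by rewrite divr_gt0// mulr_gt0.
have Ke : K * e <= kap / 16.
  have <- : (K + 1) * e = kap / 16 by rewrite /e; field; rewrite gt_eqF.
  by rewrite ler_pM2r// lerDl.
have Meta : M * eta <= kap / 40.
  have <- : (M + 1) * eta = kap / 40 by rewrite /eta; field; rewrite gt_eqF.
  by rewrite ler_pM2r// lerDl.
clearbody e eta.
have [k [s [p hn]]] := equicont e0 eta0.
pose sg u := s (p u).
have [r [t [B [mB PB hB]]]] := tight_oscillation bZ sg tZ e0 eta0.
have [mA PA] := fidi_oscillation t e0 eta0 hn.
set A := [set w | _] in mA PA.
(* [L] evaluated at a path that is constant on the fibres of [p]: a continuous function of [k]
   coordinates, to which [fidi] applies. *)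
pose phi (v : 'rV[R]_k) := L (fun u => v 0 (p u)).
have row_linf (v : 'rV[R]_k) : linf (fun u : I => v 0 (p u)).
  exists (\big[Num.max/0]_(i < k) `|v 0 i|) => u.
  exact: (le_bigmax 0 (fun i => `|v 0 i|) (p u)).
have cphi : continuous phi.
  apply: (lipschitz_row_continuous (C := K)) => u v c c0 uv.
  by apply: hL => // i; exact: uv.
have phiM v : `|phi v| <= M by exact: LM.
pose V n w := phi (\row_i Zn n w (s i)).
pose W w := phi (\row_i Z w (s i)).
have VE n w : V n w = L (fun u => Zn n w (sg u)).
  by rewrite /V /phi; congr L; apply/funext => u; rewrite mxE.
have WE w : W w = L (fun u => Z w (sg u)).
  by rewrite /W /phi; congr L; apply/funext => u; rewrite mxE.
have mZ u : measurable_fun [set: T'] (fun w => Z w u).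
  apply: (borel_linf_measurable bZ (hh := fun x => x u)).
  exact: lipschitz_linf_continuous (lipschitz_linf_eval u).
have mV n : measurable_fun [set: T] (V n) by apply: measurable_fun_row.
have mW : measurable_fun [set: T'] W by apply: measurable_fun_row.
have mLZ : measurable_fun [set: T'] (fun w => L (Z w)).
  exact: (borel_linf_measurable bZ (lipschitz_linf_continuous lipL)).
have sg_linf (x : I -> R) : linf x -> linf (fun u => x (sg u)).
  by move=> [N hN]; exists N.
have close x (c : R) : linf x -> 0 <= c ->
    (forall u, `|x u - x (sg u)| <= c) -> `|L x - L (fun u => x (sg u))| <= K * c.
  by move=> Ix c0 h; apply: hL => //; exact: sg_linf.
have far x : linf x -> `|L x - L (fun u => x (sg u))| <= 2 * M.
  move=> Ix; have := LM x Ix; have := LM _ (sg_linf x Ix).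
  rewrite !ler_norml => /andP[? ?] /andP[? ?].
  by apply/andP; split; lra.
have mBA : measurable (B `|` A) by exact: measurableU.
have PBA : (P' (B `|` A) <= (3 * eta)%:E)%E.
  apply: le_trans (measureU2 _ mB mA) _; apply: le_trans (leeD PB PA) _.
  by rewrite -EFinD lee_fin; lra.
(* On the exceptional event only the crude bound [2 * M] is used. Off it, the exclusion of [A] rules
   out the second alternative of [tight_oscillation]. *)
have Zclose w : `|L (Z w) - W w| <= K * (3 * e) + 2 * M * \1_(B `|` A) w.
  rewrite WE indicE; case: (boolP (w \in B `|` A)) => [_|].
    apply: le_trans (far _ (bZ.1 w)) _; rewrite mulr1 lerDr.
    by rewrite !mulr_ge0// ltW.
  rewrite notin_setE => /not_orP [nB nA]; rewrite mulr0 addr0.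
  apply: close; [exact: bZ.1|lra|].
  by have [//|[j hj]] := hB w nB; exfalso; apply: nA; exists j.
have M20 : 0 <= 2 * M by rewrite mulr_ge0.
have LZM w : `|L (Z w)| <= M by apply: LM; exact: bZ.1.
have WM w : `|W w| <= M by exact: phiM.
have VM n w : `|V n w| <= M by exact: phiM.
have WZ : (\int[P']_w (W w)%:E <=
    \int[P']_w (L (Z w))%:E + (K * (3 * e) + 2 * M * (3 * eta))%:E)%E.
  apply: (integral_le_perturb mW mLZ WM LZM mBA M20 PBA) => w.
  by have := Zclose w; rewrite ler_norml => /andP[? ?]; lra.
have ZW : (\int[P']_w (L (Z w))%:E <=
    \int[P']_w (W w)%:E + (K * (3 * e) + 2 * M * (3 * eta))%:E)%E.
  apply: (integral_le_perturb mLZ mW LZM WM mBA M20 PBA) => w.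
  by have := Zclose w; rewrite ler_norml => /andP[? ?]; lra.
have finW : (\int[P']_w (W w)%:E)%E \is a fin_num.
  exact: integrable_fin_num (integrable_bounded P' mW WM).
have finZ : (\int[P']_w (L (Z w))%:E)%E \is a fin_num.
  exact: integrable_fin_num (integrable_bounded P' mLZ LZM).
have finV n : (\int[P]_w (V n w)%:E)%E \is a fin_num.
  exact: integrable_fin_num (integrable_bounded P (mV n) (VM n)).
have := @fidi _ s _ cphi (ex_intro _ M phiM).
rewrite -[X in _ --> X](fineK finW) => /fine_cvgP [_ /cvgrPdist_le].
have kap40 : 0 < kap / 4 by rewrite divr_gt0.
move=> /(_ _ kap40) hV.
near=> n.
have hVn : `|fine (\int[P']_w (W w)%:E) - fine (\int[P]_w (V n w)%:E)| <= kap / 4.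
  by near: n; exact: hV.
have : (outer_prob P [set w | exists u, (e < `|Zn n w u - Zn n w (sg u)|)%R]
    < (2 * eta)%:E)%E.
  apply: (@le_lt_trans _ _ eta%:E); first by near: n.
  by rewrite lte_fin; lra.
move=> /ereal_inf_lt [_ [D [mD subD] <-] /ltW PD].
have nclose w : `|L (Zn n w) - V n w| <= K * e + 2 * M * \1_D w.
  rewrite VE indicE; case: (boolP (w \in D)) => [_|].
    apply: le_trans (far _ (Zn_linf n w)) _; rewrite mulr1 lerDr.
    by rewrite mulr_ge0// ltW.
  rewrite notin_setE => nD; rewrite mulr0 addr0.
  apply: close => //; first exact: ltW.
  by move=> u; rewrite leNgt; apply/negP => hu; apply: nD; apply: subD; exists u.
have mD1 : measurable_fun [set: T] (\1_D : T -> R) by exact: measurable_indic.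
have indM w : `|2 * M * \1_D w : R| <= 2 * M.
  by rewrite indicE; case: (w \in D); rewrite ?mulr1 ?mulr0 ?normr0// ger0_norm.
have mU : measurable_fun [set: T] (fun w => V n w + (K * e + 2 * M * \1_D w)).
  apply: measurable_funD => //; apply: measurable_funD => //.
  exact: measurable_funM.
have mL : measurable_fun [set: T] (fun w => V n w - (K * e + 2 * M * \1_D w)).
  apply: measurable_funB => //; apply: measurable_funD => //.
  exact: measurable_funM.
have Ke0 : 0 <= K * e by rewrite mulr_ge0// ltW.
have UM w : `|V n w + (K * e + 2 * M * \1_D w)| <= M + (K * e + 2 * M).
  have := VM n w; have := indM w; rewrite !ler_norml => /andP[? ?] /andP[? ?].
  by apply/andP; split; lra.
have LM' w : `|V n w - (K * e + 2 * M * \1_D w)| <= M + (K * e + 2 * M).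
  have := VM n w; have := indM w; rewrite !ler_norml => /andP[? ?] /andP[? ?].
  by apply/andP; split; lra.
have VM' w : `|V n w| <= M + (K * e + 2 * M).
  by apply: le_trans (VM n w) _; rewrite lerDl addr_ge0.
split.
  have h1 : (outer_expect P (fun w => (L (Zn n w))%:E) <=
      \int[P]_w (V n w + (K * e + 2 * M * \1_D w))%:E)%E.
    apply: (outer_expect_le_integral P mU UM) => w; rewrite lee_fin.
    by have := nclose w; rewrite ler_norml => /andP[? ?]; lra.
  have h2 := integral_le_perturb mU (mV n) UM VM' mD M20 PD (fun w => lexx _).
  apply: le_trans h1 _; apply: le_trans h2 _.
  move: hVn WZ; rewrite -(fineK (finV n)) -(fineK finW) -(fineK finZ) /=.
  rewrite -!EFinD !lee_fin ler_norml => /andP[? ?] ?; lra.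
have h1 : (\int[P]_w (V n w - (K * e + 2 * M * \1_D w))%:E <=
    outer_expect P (fun w => (L (Zn n w))%:E))%E.
  apply: (integral_le_outer_expect P mL LM') => w; rewrite lee_fin.
  by have := nclose w; rewrite ler_norml => /andP[? ?]; lra.
have h2 : (\int[P]_w (V n w)%:E <= \int[P]_w (V n w - (K * e + 2 * M * \1_D w))%:E
    + (K * e + 2 * M * (2 * eta))%:E)%E.
  apply: (integral_le_perturb (mV n) mL VM' LM' mD M20 PD) => w.
  by rewrite subrK.
apply: le_trans h1.
have finL : (\int[P]_w (V n w - (K * e + 2 * M * \1_D w))%:E)%E \is a fin_num.
  exact: integrable_fin_num (integrable_bounded P mL LM').
move: hVn ZW h2; rewrite -(fineK (finV n)) -(fineK finW) -(fineK finZ).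
rewrite -(fineK finL) /=.
rewrite -!EFinD !lee_fin ler_norml => /andP[? ?] ? ?; lra.
Unshelve. all: by end_near.
Qed.

(* A bounded continuous functional is the monotone limit, from below and from
   above, of bounded Lipschitz ones. *)
Theorem equicontinuous_weak_conv : weak_conv_linf P P' Zn Z.
Proof.
(* Dominated convergence along [lower_reg hh n%:R] makes the loss in expectation small. The
   Lipschitz constant may be huge, which is harmless as it is fixed before the index of the process
   grows. *)
have half (hh : (I -> R) -> R) (M kap : R) : linf_continuous hh ->
    (forall x, linf x -> `|hh x| <= M) -> 0 < kap ->
    exists L K, [/\ lipschitz_linf L K, forall x, linf x -> `|L x| <= M,
      forall x, linf x -> L x <= hh x &
      (\int[P']_w (hh (Z w))%:E - kap%:E <= \int[P']_w (L (Z w))%:E)%E].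
  move=> ch hM kap0.
  have hZM w : `|hh (Z w)| <= M by apply: hM; exact: bZ.1.
  have mh : measurable_fun [set: T'] (fun w => hh (Z w)).
    exact: (borel_linf_measurable bZ).
  pose Ln n := lower_reg hh n%:R.
  have lipLn n : lipschitz_linf (Ln n) n%:R by exact: lower_reg_lipschitz hM _.
  have LnM n x : linf x -> `|Ln n x| <= M by apply: lower_reg_bounded.
  have mLn n : measurable_fun [set: T'] (fun w => Ln n (Z w)).
    exact: (borel_linf_measurable bZ (lipschitz_linf_continuous (lipLn n))).
  have mLnE n : measurable_fun [set: T'] (fun w => (Ln n (Z w))%:E).
    exact/measurable_EFinP.
  have mhE : measurable_fun [set: T'] (fun w => (hh (Z w))%:E).
    exact/measurable_EFinP.
  have Lncv : \forall w \ae P', setT w ->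
      (fun n => (Ln n (Z w))%:E) @ \oo --> (hh (Z w))%:E.
    apply: aeW => w _; apply: cvg_EFin; first by near=> n.
    exact: lower_reg_cvg hM ch (bZ.1 w).
  have LnMae : \forall w \ae P', forall n : nat, setT w ->
      (`|(Ln n (Z w))%:E| <= (EFin \o cst M) w)%E.
    by apply: aeW => w n _; rewrite abse_EFin lee_fin; exact: LnM (bZ.1 w).
  have iM := finite_measure_integrable_cst P' M measurableT.
  have [_ _ hcv] := dominated_convergence measurableT mLnE mhE Lncv iM LnMae.
  have finh : (\int[P']_w (hh (Z w))%:E)%E \is a fin_num.
    exact: integrable_fin_num (integrable_bounded P' mh hZM).
  move: hcv; rewrite -[X in _ --> X](fineK finh) => /fine_cvgP [_].
  move=> /cvgrPdist_le /(_ _ kap0) /filter_ex [n hn].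
  exists (Ln n), n%:R; split => //; first exact: LnM.
    by move=> x Ix; exact: (lower_reg_le hM (ler0n R n) Ix).
  have finL : (\int[P']_w (Ln n (Z w))%:E)%E \is a fin_num.
    have LnZ w : `|Ln n (Z w)| <= M by exact: LnM (bZ.1 w).
    exact: integrable_fin_num (integrable_bounded P' (mLn n) LnZ).
  move: hn => /=; rewrite -(fineK finh) -(fineK finL) /= -EFinB lee_fin.
  by rewrite ler_norml => /andP[_ ?]; lra.
move=> hh ch [M hM].
have hZM w : `|hh (Z w)| <= M by apply: hM; exact: bZ.1.
have mh : measurable_fun [set: T'] (fun w => hh (Z w)).
  exact: (borel_linf_measurable bZ).
have finh : (\int[P']_w (hh (Z w))%:E)%E \is a fin_num.
  exact: integrable_fin_num (integrable_bounded P' mh hZM).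
have bounds (kap : R) : 0 < kap -> \forall n \near \oo,
    (\int[P']_w (hh (Z w))%:E - kap%:E <=
      outer_expect P (fun w => (hh (Zn n w))%:E) <=
      \int[P']_w (hh (Z w))%:E + kap%:E)%E.
  move=> kap0; have k2 : 0 < kap / 2 by lra.
  have [L [K [lipL LM Lh hL]]] := half hh M (kap / 2) ch hM k2.
  have cN : linf_continuous (fun x => - hh x).
    move=> x Ix e e0; have [r r0 hr] := ch x Ix e e0; exists r => // y Iy xy.
    by rewrite -opprD normrN hr.
  have hNM x : linf x -> `|- hh x| <= M by move=> Ix; rewrite normrN hM.
  (* Applied to [- hh], so that [- L'] is the Lipschitz function lying above [hh]. *)
  have [L' [K' [lipL' LM' Lh' hL']]] := half _ M (kap / 2) cN hNM k2.
  have lipN : lipschitz_linf (fun x => - L' x) K'.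
    split; first exact: lipL'.1.
    move=> x y c Ix Iy c0 xy.
    by rewrite -opprD normrN; apply: lipL'.2.
  have LNM x : linf x -> `|- L' x| <= M by move=> Ix; rewrite normrN LM'.
  have mL' : measurable_fun [set: T'] (fun w => L' (Z w)).
    exact: (borel_linf_measurable bZ (lipschitz_linf_continuous lipL')).
  have LZ' w : `|L' (Z w)| <= M by exact: LM' (bZ.1 w).
  have finL' : (\int[P']_w (L' (Z w))%:E)%E \is a fin_num.
    exact: integrable_fin_num (integrable_bounded P' mL' LZ').
  have intN (f : T' -> R) : P'.-integrable setT (fun w => (f w)%:E) ->
      (\int[P']_w (- f w)%:E = - \int[P']_w (f w)%:E)%E.
    move=> fi; under eq_integral do rewrite -mulN1r EFinM.
    by rewrite (integralZl measurableT fi) EFinN mulN1e.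
  have c1 := lipschitz_weak_conv lipL LM k2.
  have c2 := lipschitz_weak_conv lipN LNM k2.
  apply: filterS (filterI c1 c2) => n [[_ n1] [n2 _]]; apply/andP; split.
  - apply: (@le_trans _ _ (outer_expect P (fun w => (L (Zn n w))%:E))).
      apply: le_trans n1; rewrite leeBrDr//.
      apply: le_trans hL; rewrite -(fineK finh) -!EFinB -EFinD lee_fin; lra.
    by apply: outer_expect_le => w; rewrite lee_fin Lh.
  - apply: (@le_trans _ _ (outer_expect P (fun w => (- L' (Zn n w))%:E))).
      by apply: outer_expect_le => w; rewrite lee_fin lerNr Lh'.
    apply: le_trans n2 _.
    rewrite intN; last exact: (integrable_bounded P' mL' LZ').
    move: hL'; rewrite intN; last exact: (integrable_bounded P' mh hZM).
    rewrite -(fineK finh) -(fineK finL') -!EFinN -!EFinD !lee_fin; lra.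
(* Convergence in the extended reals first asks for finite values, which the bounds with [kap = 1]
   provide for large [n]. *)
rewrite -(fineK finh); apply/fine_cvgP; split.
  near=> n.
  have /andP[h1 h2] : (\int[P']_w (hh (Z w))%:E - 1%:E <=
      outer_expect P (fun w => (hh (Zn n w))%:E) <=
      \int[P']_w (hh (Z w))%:E + 1%:E)%E by near: n; exact: bounds.
  rewrite fin_numElt; apply/andP; split.
    by apply: lt_le_trans h1; rewrite -(fineK finh) -EFinB ltNyr.
  by apply: le_lt_trans h2 _; rewrite -(fineK finh) -EFinD ltry.
apply/cvgrPdist_le => kap kap0; near=> n.
have : (\int[P']_w (hh (Z w))%:E - kap%:E <=
    outer_expect P (fun w => (hh (Zn n w))%:E) <=
    \int[P']_w (hh (Z w))%:E + kap%:E)%E by near: n; exact: bounds.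
rewrite /= -(fineK finh); case: (outer_expect P _) => [x| |] /=; last 2 first.
- by rewrite leye_eq andbF.
- by [].
rewrite ?lee_fin => /andP[? ?].
by rewrite ler_norml; apply/andP; split; lra.
Unshelve. all: by end_near.
Qed.

End WeakConvergence.

(** * Finite nets of the index set *)

Section Nets.
Context {R : realType}.

(** One representative is kept for each attained code, so the net consists of points of [I] itself;
    closeness of points sharing a code is left to the choice of [c]. *)
Lemma finite_code_net (I : Type) (C : finType) (c : I -> C) :
  exists (k : nat) (s : 'I_k -> I) (p : I -> 'I_k),
    forall u, c (s (p u)) = c u.
Proof.
pose A : {set C} := [set x | `[< exists u, c u = x >]]%SET.
have inA u : c u \in A by rewrite inE; apply/asboolP; exists u.
have ex (i : 'I_#|A|) : exists u, c u = enum_val i.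
  by have := enum_valP i; rewrite inE => /asboolP.
exists #|A|, (fun i => projT1 (cid (ex i))), (fun u => enum_rank_in (inA u) (c u)).
by move=> u; case: cid => v /= ->; rewrite enum_rankK_in.
Qed.

Lemma finite_set_ord (A : Type) (D : set A) : finite_set D ->
  exists n (l : 'I_n -> A), forall a, D a -> exists j, l j = a.
Proof.
apply: (finite_set_ind (Q := fun D => exists n (l : 'I_n -> A),
  forall a, D a -> exists j, l j = a)).
  by exists 0%N, (fun j : 'I_0 => False_rect A (notF (ltn_ord j))).
move=> a {}D [n [l hl]].
exists n.+1, (fun j => if unlift ord0 j is Some j' then l j' else a).
move=> b [->|/hl [j <-]]; first by exists ord0; rewrite unlift_none.
by exists (lift ord0 j); rewrite liftK.
Qed.

Lemma Tidx_net (Xs : Type) (Fam : set (Xs -> R))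
    (rho : (Xs -> R) -> (Xs -> R) -> R) (dl : R) :
  semimetric_on Fam rho -> totally_bounded_on Fam rho -> 0 < dl ->
  exists (k : nat) (s : 'I_k -> Tidx Fam) (p : Tidx Fam -> 'I_k),
    forall u, tau rho (sval u) (sval (s (p u))) <= dl.
Proof.
move=> semi tb dl0.
have dl4 : 0 < dl / 4 by rewrite divr_gt0.
have [G [finG GF Gcov]] := tb _ dl4.
have [n [l hl]] := finite_set_ord finG.
(* Grid cells have width [1 / N%:R], at most [dl / 4]. Equal codes then cost [dl / 4] per end point
   and less than [dl / 2] for the functions, through their common net point. An end point equal to 1
   lies in cell [N], hence ['I_N.+1]. *)
pose N := (Num.truncn (4 / dl)).+1.
have N0 : 0 < N%:R :> R by rewrite ltr0n.
have Ndl : 4 <= dl * N%:R.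
  have /andP[_ /ltW h] := truncn_itv (divr_ge0 (ler0n R 4) (ltW dl0)).
  by rewrite mulrC -ler_pdivrMr.
(* A relation, since the empty interval has many pairs of end points; a code is chosen for each
   index afterwards. *)
pose code (u : Tidx Fam) (x : 'I_N.+1 * 'I_N.+1 * 'I_n) := exists a b : R,
  [/\ [/\ 0 <= a, a <= b, b <= 1 & (sval u).1 = [set` `]a, b]]],
      x.1.1%:R <= a * N%:R < x.1.1.+1%:R, x.1.2%:R <= b * N%:R < x.1.2.+1%:R,
      Fam (l x.2) & rho (sval u).2 (l x.2) < dl / 4].
have TF (u : Tidx Fam) : Tset Fam (sval u) by case: u => t /= /set_mem.
have codeP u : exists x, code u x.
  have [[a [b [a0 ab b1 AE]]] Fu] := TF u.
  have [f Gf rf] := Gcov _ Fu; have [j lj] := hl f Gf.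
  have idx (y : R) : 0 <= y -> y <= 1 -> exists i : 'I_N.+1,
      i%:R <= y * N%:R < i.+1%:R.
    move=> y0 y1; have yN : 0 <= y * N%:R by rewrite mulr_ge0// ltW.
    have /andP[h1 h2] := truncn_itv yN.
    have iN : (Num.truncn (y * N%:R) < N.+1)%N.
      rewrite ltnS -(ler_nat R); apply: le_trans h1 _.
      by rewrite ler_piMl// ltW.
    by exists (Ordinal iN); rewrite /= h1 h2.
  have [i hi] := idx a a0 (le_trans ab b1).
  have [i' hi'] := idx b (le_trans a0 ab) b1.
  by exists (i, i', j), a, b; split => //=; rewrite lj; [exact: GF|].
have [k [s [p hp]]] := finite_code_net (fun u => projT1 (cid (codeP u))).
exists k, s, p => u.
have close v : projT1 (cid (codeP v)) = projT1 (cid (codeP u)) ->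
    tau rho (sval u) (sval v) <= dl.
  case: cid => x /= cv; case: cid => y /= cu xy; rewrite {}xy {x} in cv.
  case: cv => a' [b' [[a'0 ab' b'1 AE'] ha' hb' Fl rv]].
  case: cu => a [b [[a0 ab b1 AE] ha hb _ ru]].
  have [_ Fu] := TF u; have [_ Fv] := TF v.
  have [_ _ sym _] := semi _ _ _ Fv Fl Fv.
  have [_ _ _ tri] := semi _ _ _ Fu Fl Fv.
  rewrite /tau AE AE'.
  have h := leb_symdiff_le ab ab'.
  have near_ (z z' : R) (i : nat) : i%:R <= z * N%:R < i.+1%:R ->
      i%:R <= z' * N%:R < i.+1%:R -> `|z - z'| <= dl / 4.
    rewrite -natr1 => /andP[? ?] /andP[? ?].
    have : `|(z - z') * N%:R| <= 1.
      by rewrite ler_norml mulrBl; apply/andP; split; lra.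
    rewrite normrM (gtr0_norm N0) => h1; rewrite -(ler_pM2r N0).
    by apply: le_trans h1 _; rewrite mulrAC ler_pdivlMr// mul1r.
  have := near_ _ _ _ ha ha'; have := near_ _ _ _ hb hb'.
  by rewrite sym in rv; lra.
by apply: close; exact: hp.
Qed.

End Nets.

(** * Boundedness and measurability of the smoothed process *)

Section SmoothedProcess.
Context {R : realType} {d dX : measure_display} {T : measurableType d}
  {Xs : measurableType dX}.
Variables (P : probability T R) (X : nat -> nat -> T -> Xs).
Variables (Fam : set (Xs -> R)) (F : Xs -> R).
Hypothesis mX :
  forall i n, (1 <= i <= n)%N -> measurable_fun [set: T] (X i n).
Hypothesis mFam : forall f, Fam f -> measurable_fun [set: Xs] f.
Hypothesis mF : measurable_fun [set: Xs] F.
Hypothesis FamF : forall f x, Fam f -> `|f x| <= F x.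
Hypothesis intF : forall i n, (1 <= i <= n)%N ->
  (\int[P]_w (F (X i n w))%:E < +oo)%E.

(** The envelope and its mean bound every centred term uniformly over [Fam], and the weights are at
    most 1. The factor 2 comes from bounding the two ends of an increment separately. *)
Lemma ZsT_linf n w : linf (ZsT P X Fam n w).
Proof.
pose b k := F (X k n w) + fine (\int[P]_v (F (X k n v))%:E).
have Zob k f : Fam f -> (1 <= k <= n)%N -> `|Zo P X n k f w| <= b k.
  move=> Ff kn; apply: le_trans (ler_normB _ _) _.
  have fi := integrable_comp mX mFam mF FamF intF Ff kn.
  have F0 x : 0 <= F x by apply: le_trans (FamF x Ff).
  have Fi : P.-integrable [set: T] (fun w => (F (X k n w))%:E).
    apply/integrableP; split.
      by apply/measurable_EFinP; apply: measurableT_comp => //; exact: mX.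
    rewrite (eq_integral (fun w => (F (X k n w))%:E)) ?intF// => v _.
    by rewrite gee0_abs ?lee_fin.
  apply: lerD; first exact: FamF.
  apply: le_trans (le_normr_Rintegral measurableT fi) _.
  apply: le_Rintegral => //; last by move=> v _; exact: FamF.
  exact: integrable_norm fi.
exists ((Num.sqrt n%:R)^-1 * (2 * \sum_(0 <= k < n) b k.+1)).
move=> [[A f] /= At]; have [/= [u [v [u0 uv v1 AE]]] Ff] := set_mem At.
rewrite /ZsT /=; case: n b Zob => [|n] b Zob.
  by rewrite /Zs !big_geq// !mulr0 normr0.
rewrite AE ZsE// normrM ger0_norm ?invr_ge0//; apply: ler_wpM2l.
  by rewrite invr_ge0.
have ib t : `|interp (fun k => Zo P X n.+1 k f w) n.+1 t| <=
    \sum_(0 <= k < n.+1) b k.+1.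
  apply: le_trans (ler_norm_sum _ _ _) _; rewrite big_nat [leRHS]big_nat.
  apply: ler_sum => k /andP[_ kn]; rewrite normrM.
  have zb := Zob k.+1 f Ff kn.
  have c1 : `|clamp (t - k%:R)| <= 1.
    by rewrite ler_norml; case: (clampE (t - k%:R)) => -[? ->]; lra.
  by apply: le_trans zb; rewrite ler_piMl.
have := ib (n.+1%:R * v); have := ib (n.+1%:R * u); rewrite !ler_norml.
by move=> /andP[? ?] /andP[? ?]; apply/andP; split; lra.
Qed.

Lemma ZsT_measurable n t :
  measurable_fun [set: T] (fun w => ZsT P X Fam n w t).
Proof.
have [_ Ff] := set_mem (svalP t).
rewrite /ZsT /Zs; apply: measurable_funM => //.
(* The range is moved into the summand because [X i n] is known to be measurable only for
   [1 <= i <= n]. *)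
rewrite [X in measurable_fun _ X](_ : _ = fun w => \sum_(1 <= i < n.+1)
  if (1 <= i < n.+1)%N
  then leb (Defs.Rint i `&` [set n%:R * x | x in (sval t).1]) *
    Zo P X n i (sval t).2 w else 0); last first.
  by apply/funext => w; rewrite big_nat big_mkcond.
apply: measurable_sum => i; case: (boolP (1 <= i < n.+1)%N) => // hi.
apply: measurable_funM => //; apply: measurable_funB => //.
by apply: measurableT_comp; [exact: mFam|exact: mX].
Qed.

End SmoothedProcess.

Unset Implicit Arguments.

Theorem theorem3p3 (R : realType)
  (d : measure_display) (Omega : measurableType d) (P : probability Omega R)
  (dX : measure_display) (Xs : measurableType dX)
  (X : nat -> nat -> Omega -> Xs)          (* X i n = X_{i,n} *)
  (Fam : set (Xs -> R)) (F : Xs -> R)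
  (rho : (Xs -> R) -> (Xs -> R) -> R) (nu : R)
  (g : nat -> R -> R) (h : nat -> R) :
  (* standing assumptions *)
  (forall i n, (1 <= i <= n)%N -> measurable_fun [set: Omega] (X i n)) ->
  (forall f, Fam f -> measurable_fun [set: Xs] f) ->
  measurable_fun [set: Xs] F ->
  (forall f x, Fam f -> `|f x| <= F x) ->
  (forall i n, (1 <= i <= n)%N -> (\int[P]_w (F (X i n w))%:E < +oo)%E) ->
  (* nu > 2, rho a semimetric on Fam *)
  2 < nu ->
  semimetric_on Fam rho ->
  (* (1) *)
  (forall n delta i j, 0 < delta -> (1 <= i)%N -> (i <= j <= n)%N ->
     (outer_expect P (fun w => ereal_sup
        [set ((`|Ssum P X n i j f w|) `^ nu)%:E | f in Fdelta Fam rho delta])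
      <= ((g (j - i + 1)%N delta) `^ (nu / 2))%:E)%E) ->
  (exists Qg : R, forall delta, 0 < delta -> condS (nu / 2) (g ^~ delta) Qg) ->
  (* (2) *)
  (forall n i j, (1 <= i)%N -> (i <= j <= n)%N ->
     (outer_expect P (fun w => ereal_sup
        [set ((`|Ssum P X n i j f w|) `^ nu)%:E | f in Fam])
      <= ((h (j - i + 1)%N) `^ (nu / 2))%:E)%E) ->
  (exists Qh : R, condS (nu / 2) h Qh) ->
  (* (3) *)
  (limn_esup (fun n => (g n delta / n%:R)%:E)) @[delta --> 0^'+] --> 0%E ->
  (* (4), with the convention h(0) = 0 *)
  (exists C : R, 0 <= C /\
     forall eps : R, 0 < eps <= 1 ->
       (limn_esup (fun n =>
          ((let m := Num.truncn (n%:R * eps) in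
            if m == 0%N then 0 else h m) / n%:R)%:E)
        <= (C * eps)%:E)%E) ->
  (* conclusions *)
  AEC P X Fam rho /\
  (totally_bounded_on Fam rho ->
   forall (d' : measure_display) (Omega' : measurableType d')
          (P' : probability Omega' R) (Z : Omega' -> Tidx Fam -> R),
     borel_linf Z -> tight_linf P' Z ->
     fidi_conv P P' (ZsT P X Fam) Z ->
     weak_conv_linf P P' (ZsT P X Fam) Z).
Proof.
move=> mX mFam mF FamF intF nu2 semi h1 Sg h2 Sh h3 h4.
have near_osc := AEC_near mX mFam mF FamF intF semi nu2 h1 h2 Sg Sh h3 h4.
split.
  move=> e e0; apply: cvge0_le => [dl|eta eta0].
    by apply: limf_esup_ge0 => // n; exact: outer_prob_ge0.
  apply: filterS (near_osc e eta e0 eta0) => dl; exact: limn_esup_le.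
move=> tb d' Omega' P' Z bZ tZ fidi.
apply: (equicontinuous_weak_conv _ _ bZ tZ fidi).
- by move=> n w; apply: (ZsT_linf mX mFam mF FamF intF).
- by move=> n t; apply: (ZsT_measurable P mX mFam).
move=> e eta e0 eta0.
(* One radius with a small oscillation for all large [n]. The net is built at the same radius, so
   each index and its net point form a pair counted in [oscillation]. *)
have [dl [dl0 hdl]] : exists dl : R, 0 < dl /\ \forall n \near \oo,
    (outer_prob P (oscillation P X Fam rho n dl e) <= eta%:E)%E.
  have near0 : \forall dl \near (0 : R)^'+, 0 < dl by exact: nbhs_right_gt.
  have /filter_ex [dl [? ?]] : \forall dl \near (0 : R)^'+, 0 < dl /\
      \forall n \near \oo,
        (outer_prob P (oscillation P X Fam rho n dl e) <= eta%:E)%E.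
    by apply: filterI; [exact: near0|exact: near_osc].
  by exists dl.
have [k [s [p hp]]] := Tidx_net semi tb dl0.
exists k, s, p; apply: filterS hdl => n; apply: le_trans.
apply: outer_prob_mono => w /= [u hu]; rewrite /oscillation /=.
apply: (@lt_le_trans _ _ `|ZsT P X Fam n w u - ZsT P X Fam n w (s (p u))|%:E).
  by rewrite lte_fin.
apply: ereal_sup_ubound; exists (sval u, sval (s (p u))) => //=.
split => /=; last exact: hp.
- exact: set_mem (svalP u).
- exact: set_mem (svalP (s (p u))).
Qed.
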